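(* Let $n\geq 3$ be an integer and let $p\geq 2$. Let $\bar\gamma_{n,p}$ be the infimum of all real numbers $\gamma$ such that, for every $\varepsilon>0$, there is a constant $C_\varepsilon>0$ for which $$\Big\| \sup_{0<t\le R} |e^{it\Delta}f| \Big\|_{L^p(B^n(0,R))} \le C_\varepsilon R^{\varepsilon} R^{\gamma}\,\|f\|_{L^2(\mathbb{R}^n)}$$ holds for all $R>1$ and all $f\in L^2(\mathbb{R}^n)$ with $\operatorname{supp}\widehat f\subset B^n(0,1)$. Then for every integer $m$ with $1\leq m\leq n$, $$\bar\gamma_{n,p}\;\geq\; \frac{n+m}{2}\left(\frac1p-\frac12\right)+\frac{m}{2(m+1)}.$$
   Context: $B^n(0,r)$ denotes the ball in $\mathbb{R}^n$ of radius $r$ centered at the origin. For $f$ on $\mathbb{R}^n$, the solution to the free Schr\''odinger equation $iu_t-\Delta u=0$ with $u(x,0)=f(x)$ is denoted $$e^{it\Delta}f(x)=(2\pi)^{-n/2}\int_{\mathbb{R}^n} e^{i(x\cdot\xi+t|\xi|^2)}\,\widehat f(\xi)\,d\xi,$$ where $\widehat f$ is the Fourier transform of $f$, with the normalization for which $e^{i0\Delta}f=f$. The constant $C_\varepsilon$ may depend on $\varepsilon$, $n$, $p$, $\gamma$ but not on $R$ or $f$. *)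

(* Defs.v *)
From HB Require Import structures.
From mathcomp Require Import all_boot all_order all_algebra.
From mathcomp Require Import complex.
From mathcomp Require Import all_classical all_reals all_analysis.

Set Implicit Arguments.
Unset Strict Implicit.
Unset Printing Implicit Defensive.
Import Order.TTheory GRing.Theory Num.Theory.
Import numFieldNormedType.Exports.
Local Open Scope classical_set_scope.
Local Open Scope ring_scope.
Local Open Scope complex_scope.

Notation Rn R n := (n.-tuple (measurableTypeR R)).

Section lebesgue_rn.
Context (R : realType).
Local Open Scope ereal_scope.

Definition rn_cons n (z : Rn R n * measurableTypeR R) : Rn R n.+1 :=
  [tuple of z.2 :: z.1].

Lemma measurable_rn_cons n :
  measurable_fun [set: Rn R n * measurableTypeR R] (@rn_cons n).
Proof. exact: measurable_cons. Qed.

Section step.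
Context n (m : {measure set (Rn R n) -> \bar R}).

Definition lebesgue_rn_step : set (Rn R n.+1) -> \bar R :=
  pushforward (m \x (@lebesgue_measure R)) (@rn_cons n).

Let mcons A : measurable A -> measurable (@rn_cons n @^-1` A).
Proof. by move=> mA; rewrite -[X in measurable X]setTI; exact: measurable_rn_cons. Qed.

Let step0 : lebesgue_rn_step set0 = 0.
Proof. by rewrite /lebesgue_rn_step /pushforward preimage_set0 measure0. Qed.

Let step_ge0 A : 0 <= lebesgue_rn_step A.
Proof. by rewrite /lebesgue_rn_step /pushforward; exact: measure_ge0. Qed.

Let step_sigma_additive : semi_sigma_additive lebesgue_rn_step.
Proof.
move=> F mF tF mUF; rewrite /lebesgue_rn_step /pushforward preimage_bigcup.
apply: measure_semi_sigma_additive.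
- by move=> k; exact: mcons.
- apply/trivIsetP => i j _ _ ij; rewrite -preimage_setI.
  by move/trivIsetP : tF => /(_ _ _ _ _ ij) ->//; rewrite preimage_set0.
- by rewrite -preimage_bigcup; exact: mcons.
Qed.

HB.instance Definition _ := isMeasure.Build _ _ _ lebesgue_rn_step
  step0 step_ge0 step_sigma_additive.

End step.

Fixpoint lebesgue_rn n : {measure set (Rn R n) -> \bar R} :=
  if n is k.+1 then lebesgue_rn_step (lebesgue_rn k)
  else \d_([tuple] : Rn R 0).

Lemma lebesgue_rn_box n (A : 'I_n -> set (measurableTypeR R)) :
  (forall i, measurable (A i)) ->
  lebesgue_rn n [set x | forall i, A i (tnth x i)] =
  \prod_(i < n) lebesgue_measure (A i).
Proof.
elim: n A => [|n IH] A mA.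
  by rewrite big_ord0 /= diracE mem_set// => -[].
rewrite big_ord_recl /= /lebesgue_rn_step /pushforward.
set P := _ @^-1` _.
have -> : P = [set x | forall i, A (lift ord0 i) (tnth x i)] `*` A ord0.
  rewrite /P; apply/seteqP; split=> -[x y] /=.
    move=> H; split=> [i|]; last exact: (H ord0).
    by have := H (lift ord0 i); rewrite /rn_cons tnthS.
  move=> [H1 H2] i; have [j ->|->] := unliftP ord0 i; last by [].
  by rewrite /rn_cons tnthS; exact: H1.
rewrite product_measure1E//; first by rewrite (IH (fun i => A (lift ord0 i)))// muleC.
have -> : [set x | forall i, A (lift ord0 i) (tnth x i)] =
    \bigcap_(i in [set: 'I_n]) ((@tnth n (measurableTypeR R) ^~ i) @^-1` A (lift ord0 i)).
  by apply/seteqP; split=> x H i; [move=> _; exact: H | exact: H].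
apply: fin_bigcap_measurable; first exact: finite_finset.
move=> i _; rewrite -[X in measurable X]setTI.
exact: measurable_tnth.
Qed.

End lebesgue_rn.

Section fourier.
Context {R : realType} {n : nat}.
Implicit Types (f g : Rn R n -> R[i]) (x xi : Rn R n).

Local Notation mu := (lebesgue_rn R n).
Local Notation normc := ComplexField.Normc.normc.

Definition dot x xi : R := \sum_(i < n) tnth x i * tnth xi i.

Definition enorm x : R := Num.sqrt (dot x x).

Definition eball (c : Rn R n) (r : R) : set (Rn R n) :=
  [set x | enorm [tuple tnth x i - tnth c i | i < n] < r].

Definition origin : Rn R n := [tuple 0 | i < n].

Definition expi (theta : R) : R[i] := cos theta +i* sin theta.

Definition cintegral f : R[i] :=
  (\int[mu]_x complex.Re (f x)) +i* (\int[mu]_x complex.Im (f x)).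

Definition cLnorm (p : R) f : \bar R := Lnorm mu p%:E (fun x => (normc (f x))%:E).

(* Membership in L^p(R^n); functions stand for their a.e. classes. *)
Definition inLp (p : R) f : Prop :=
  [/\ measurable_fun setT (fun x => complex.Re (f x)),
      measurable_fun setT (fun x => complex.Im (f x)) &
      (cLnorm p f < +oo)%E].

Definition fourier_cst : R := (2 * pi) `^ (- (n%:R / 2)).

Definition fourierL1 f xi : R[i] :=
  fourier_cst%:C * cintegral (fun x => expi (- dot x xi) * f x).

(* [is_fourier f g]: g represents the Fourier transform of f in L^2, i.e. the
   continuous extension to L^2 of [fourierL1] on L^1 and L^2. By Plancherel, g is
   determined by f up to a null set. *)
Definition is_fourier f g : Prop :=
  [/\ inLp 2 f, inLp 2 g &
   exists u : nat -> Rn R n -> R[i],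
   [/\ forall k, inLp 1 (u k) /\ inLp 2 (u k),
       cLnorm 2 (fun x => u k x - f x) @[k --> \oo] --> 0%E &
       cLnorm 2 (fun xi => fourierL1 (u k) xi - g xi) @[k --> \oo] --> 0%E]].

(* Support of an a.e. class: complement of the largest open set on which it
   vanishes almost everywhere. *)
Definition ess_support g : set (Rn R n) :=
  [set xi | forall r : R, 0 < r ->
     ~ {ae mu, forall eta, eball xi r eta -> g eta = 0}].

(* The free Schroedinger evolution at time t, in terms of the Fourier
   transform g of the initial datum. *)
Definition schrodinger g (t : R) x : R[i] :=
  fourier_cst%:C *
  cintegral (fun xi => expi (dot x xi + t * enorm xi ^+ 2) * g xi).

Definition schrodinger_max g (rho : R) x : \bar R :=
  ereal_sup [set (normc (schrodinger g t x))%:E | t in `]0, rho]].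

(* [\_] extends by zero off the ball, so this is the L^p norm over the ball. *)
Definition maximal_Lp_norm (p : R) g (rho : R) : \bar R :=
  Lnorm mu p%:E (schrodinger_max g rho \_ (eball origin rho)).

End fourier.

Section exponent.
Context {R : realType}.

Definition maximal_exponent (n : nat) (p gamma : R) : Prop :=
  forall eps : R, 0 < eps -> exists C : R, 0 < C /\
    forall (rho : R) (f g : Rn R n -> R[i]),
      1 < rho -> inLp 2 f -> is_fourier f g ->
      ess_support g `<=` eball origin 1 ->
      (maximal_Lp_norm p g rho <=
        (C * rho `^ eps * rho `^ gamma)%:E * cLnorm 2 f)%E.

Definition gamma_bar (n : nat) (p : R) : \bar R :=
  ereal_inf [set gamma%:E | gamma in maximal_exponent n p].

End exponent.

(* Main.v *)
(** The exponent is tested on tensor products of one-dimensional packets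
[phi(b x) * \sum_l e^{i nu_l x}], where [phi(x) = 2 (1 - cos x) / x^2] has the tent
function as Fourier transform, so that the frequency support is exactly compact.

Fix a large integer [M], and let [R] be of order [M^(2(m+1))].  Number the coordinates
[0, ..., n-1].  Coordinate [0] carries one packet of width [R^(1/2)], travelling at
constant speed; coordinates [i >= m] carry one packet of width [R^(1/2)] at rest; each
coordinate [0 < i < m] carries packets of width [R] at the frequencies
[1 / (2 M^(i+1)) + l / M], [0 <= l < c M].  Consider times [t = 2 pi k M^2].  The phases
[t l^2 / M^2] are then multiples of [2 pi], and the [l]-sum in coordinate [i] is coherent
as soon as [x_i / (2 pi M) + k / M^i] lies in [[0, 1/M]] modulo [1].  For a given [x], the
travelling packet allows a window of [M^(m-1)] consecutive values of [k]; writing [k] in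
base [M], its digits can be chosen one after the other so as to satisfy all [m - 1]
conditions.  Hence on a box of measure comparable to [R^m R^((n-m)/2)] the maximal
function is comparable to the number [M^(m-1)] of frequencies, and letting [M] tend to
infinity yields the exponent. This is a variant, in the spirit of Luca and Rogers, of
Bourgain's example, without Gauss sums. *)

From HB Require Import structures.
Require Import Defs.
From mathcomp Require Import all_boot all_order all_algebra.
From mathcomp Require Import complex.
From mathcomp Require Import all_classical all_reals all_analysis.
From mathcomp Require Import measurable_realfun.
From mathcomp Require Import ring lra.
Import Order.TTheory GRing.Theory Num.Theory.
Import numFieldNormedType.Exports.
Local Open Scope classical_set_scope.
Local Open Scope ring_scope.
Set Implicit Arguments.
Unset Strict Implicit.
Unset Printing Implicit Defensive.

(** * The Fourier transform of the Fejer kernel *)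

Section fejer.
Context {R : realType}.
Implicit Types a b s x : R.
Local Notation mu := (@lebesgue_measure R).

Lemma cvg_expRM_y (c : R) : 0 < c -> expR (- (c * x)) @[x --> +oo] --> (0 : R).
Proof.
move=> c0.
rewrite (_ : (fun x => expR (- (c * x))) = (fun z => expR (- z)) \o (fun z => c * z)) //.
apply: (@cvg_comp _ _ _ _ _ _ (pinfty_nbhs R)); last exact: cvgr_expR.
exact: gt0_cvgMry.
Qed.

Lemma integral_id_expR x : 0 < x ->
  (\int[mu]_(s in `[0%R, +oo[) (s * expR (- (x * s)))%:E = (x ^- 2)%:E)%E.
Proof.
move=> x0; have xn0 : x != 0 by rewrite gt_eqF.
pose F (s : R) := - (s / x + x ^- 2) * expR (- (x * s)).
have dF (s : R) : is_derive s 1 F (s * expR (- (x * s))).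
  apply: is_derive_eq; rewrite /GRing.scale /=; field; exact: xn0.
rewrite (@ge0_continuous_FTC2y _ _ F _ 0).
- by rewrite -EFinB /F mul0r !add0r !mulr0 oppr0 expR0 mulr1 opprK.
- by move=> s s0; rewrite mulr_ge0 ?expR_ge0.
- apply: continuous_subspaceT => s.
  apply: cvgM; first exact: cvg_id.
  apply: continuous_comp; last exact: continuous_expR.
  by apply: cvgN; apply: cvgMr; exact: cvg_id.
- apply/norm_cvg0P.
  (* Half of the exponential absorbs the linear factor: [x s / 2 <= exp (x s / 2)] turns
     [(s / x) exp (- x s)] into at most [(2 / x^2) exp (- x s / 2)]. *)
  have K : (fun s : R => 2 / x ^+ 2 * expR (- ((x / 2) * s)) + x ^- 2 * expR (- (x * s)))
            @ +oo --> 0.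
    rewrite -[X in _ --> X]addr0; apply: cvgD.
      rewrite -[X in _ --> X](mulr0 (2 / x ^+ 2)).
      apply: cvgMr; apply: cvg_expRM_y; exact: divr_gt0.
    rewrite -[X in _ --> X](mulr0 (x ^- 2)).
    by apply: cvgMr; exact: cvg_expRM_y.
  apply: (squeeze_cvgr _ (cvg_cst 0) K).
  near=> s.
  have s0 : 0 <= s by near: s; exact: nbhs_pinfty_ge.
  rewrite normr_ge0 /= /F normrM normrN (ger0_norm (expR_ge0 _)) ger0_norm; last first.
    by rewrite addr_ge0 ?divr_ge0 ?invr_ge0 ?exprn_ge0 // ltW.
  rewrite mulrDl lerD2r.
  have -> : - (x * s) = - (x / 2 * s) + - (x / 2 * s) by field.
  rewrite expRD mulrA ler_pM2r ?expR_gt0 // expRN ler_pdivrMr ?expR_gt0 //.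
  apply: (@le_trans _ _ (2 / x ^+ 2 * (x / 2 * s))).
    by rewrite le_eqVlt; apply/orP; left; apply/eqP; field.
  rewrite ler_pM2l ?divr_gt0 ?exprn_gt0 //.
  by apply: le_trans (expR_ge1Dx _); rewrite lerDr.
- by move=> s _; exact: (@ex_derive _ _ _ _ _ _ _ (dF s)).
- apply: cvg_at_right_filter.
  apply/differentiable_continuous/derivable1_diffP; exact: (@ex_derive _ _ _ _ _ _ _ (dF 0)).
- by move=> s _; rewrite derive1E; exact: (@derive_val _ _ _ _ _ _ _ (dF s)).
Unshelve. all: by end_near.
Qed.

(** This Laplace transform of [1 - cos (a x)] is the inner integral once Tonelli has put the
    integration in [x] first. The antiderivative [F] is explicit. *)
Lemma integral_expR_1Bcos a s : 0 < s ->
  (\int[mu]_(x in `[0%R, +oo[) (expR (- (s * x)) * (1 - cos (a * x)))%:E =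
   (s^-1 - s / (s ^+ 2 + a ^+ 2))%:E)%E.
Proof.
move=> s0; have sn0 : s != 0 by rewrite gt_eqF.
have sa0 : s ^+ 2 + a ^+ 2 != 0 by rewrite gt_eqF // ltr_pwDl ?exprn_gt0 ?sqr_ge0.
pose F (x : R) := expR (- (s * x)) *
  ((s * cos (a * x) - a * sin (a * x)) / (s ^+ 2 + a ^+ 2) - s^-1).
have dF (x : R) : is_derive x 1 F (expR (- (s * x)) * (1 - cos (a * x))).
  apply: is_derive_eq; rewrite /GRing.scale /=; field; rewrite sn0; exact: sa0.
rewrite (@ge0_continuous_FTC2y _ _ F _ 0).
- by rewrite -EFinB /F !mulr0 oppr0 expR0 cos0 sin0 mulr1 mulr0 subr0 mul1r sub0r opprB.
- by move=> x _; rewrite mulr_ge0 ?expR_ge0 // subr_ge0 cos_le1.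
- apply: continuous_subspaceT => x.
  apply: cvgM.
    apply: continuous_comp; last exact: continuous_expR.
    by apply: cvgN; apply: cvgMr; exact: cvg_id.
  apply: cvgB; first exact: cvg_cst.
  apply: continuous_comp; last exact: continuous_cos.
  by apply: cvgMr; exact: cvg_id.
- apply/norm_cvg0P.
  pose C := (s + `|a|) / (s ^+ 2 + a ^+ 2) + s^-1.
  have K : (fun x : R => expR (- (s * x)) * C) @ +oo --> 0.
    rewrite -[X in _ --> X](mul0r C).
    by apply: cvgMl; exact: cvg_expRM_y.
  apply: (squeeze_cvgr _ (cvg_cst 0) K).
  near=> x.
  rewrite normr_ge0 /= /F normrM (ger0_norm (expR_ge0 _)) ler_pM2l ?expR_gt0 //.
  apply: le_trans (ler_normB _ _) _.
  rewrite (gtr0_norm (_ : 0 < s^-1)) ?invr_gt0 // /C lerD2r normrM.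
  rewrite (gtr0_norm (_ : 0 < (_ + _)^-1)); last first.
    by rewrite invr_gt0 ltr_pwDl ?exprn_gt0 ?sqr_ge0.
  apply: ler_wpM2r; first by rewrite invr_ge0 addr_ge0 ?sqr_ge0.
  apply: le_trans (ler_normB _ _) _; rewrite !normrM (gtr0_norm s0) lerD //.
    by rewrite ler_piMr ?(ltW s0) // ler_norml cos_geN1 cos_le1.
  by rewrite ler_piMr // ler_norml sin_geN1 sin_le1.
- by move=> x _; exact: (@ex_derive _ _ _ _ _ _ _ (dF x)).
- apply: cvg_at_right_filter.
  apply/differentiable_continuous/derivable1_diffP; exact: (@ex_derive _ _ _ _ _ _ _ (dF 0)).
- by move=> x _; rewrite derive1E; exact: (@derive_val _ _ _ _ _ _ _ (dF x)).
Unshelve. all: by end_near.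
Qed.

(** The outer integral, in [s], that remains after the Laplace transform; the antiderivative is
    [a atan (s / a)]. *)
Lemma integral_poisson a : 0 < a ->
  (\int[mu]_(s in `[0%R, +oo[) (a ^+ 2 / (s ^+ 2 + a ^+ 2))%:E = (a * (pi / 2))%:E)%E.
Proof.
move=> a0; have an0 : a != 0 by rewrite gt_eqF.
have sa0 (s : R) : s ^+ 2 + a ^+ 2 != 0.
  by rewrite gt_eqF // ltr_wpDl ?exprn_gt0 ?sqr_ge0.
pose F (s : R) := a * atan (a^-1 * s).
have dF (s : R) : is_derive s 1 F (a ^+ 2 / (s ^+ 2 + a ^+ 2)).
  apply: is_derive_eq; rewrite /GRing.scale /=; field.
  by rewrite an0 sa0.
rewrite (@ge0_continuous_FTC2y _ _ F _ (a * (pi / 2))).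
- by rewrite -EFinB /F mulr0 atan0 mulr0 subr0.
- by move=> s _; rewrite divr_ge0 ?addr_ge0 ?sqr_ge0.
- apply: continuous_subspaceT => s.
  apply: cvgMr; apply: cvgV => //.
  by apply: cvgD; [exact: exprn_continuous|exact: cvg_cst].
- apply: cvgMr.
  rewrite (_ : (fun x => atan (a^-1 * x)) = atan \o (fun z => a^-1 * z)) //.
  apply: (@cvg_comp _ _ _ _ _ _ (pinfty_nbhs R)); last exact: cvgy_atan.
  by apply: gt0_cvgMry => //; rewrite invr_gt0.
- by move=> x _; exact: (@ex_derive _ _ _ _ _ _ _ (dF x)).
- apply: cvg_at_right_filter.
  apply/differentiable_continuous/derivable1_diffP; exact: (@ex_derive _ _ _ _ _ _ _ (dF 0)).
- by move=> x _; rewrite derive1E; exact: (@derive_val _ _ _ _ _ _ _ (dF x)).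
Qed.

Lemma measurable_cos : measurable_fun [set: R] (@cos R).
Proof. by apply: continuous_measurable_fun; exact: continuous_cos. Qed.

Lemma measurable_sin : measurable_fun [set: R] (@sin R).
Proof. by apply: continuous_measurable_fun; exact: continuous_sin. Qed.

Lemma measurable_expRN_M a : measurable_fun [set: R] (fun x => expR (- (a * x))).
Proof.
apply: measurableT_comp; first exact: measurable_expR.
by apply: measurableT_comp; [exact: oppr_measurable|exact: measurable_funM].
Qed.

Lemma ge0_integral_halves (f : R -> \bar R) :
  measurable_fun [set: R] f -> (forall x, 0 <= f x)%E ->
  (\int[mu]_x f x = \int[mu]_(x in `[0%R, +oo[) f x +
                    \int[mu]_(x in `[0%R, +oo[) f (- x)%R)%E.
Proof.
move=> mf f0.
rewrite -(setUv `[0, +oo[%classic) ge0_integral_setU //=; last 3 first.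
- exact: measurableC.
- by rewrite setUv.
- exact/disj_setPCl.
congr (_ + _)%E.
rewrite setCitvr integral_itv_bndo_bndc; last exact: measurable_funTS.
rewrite ge0_integration_by_substitution0 //.
  by apply: eq_integral => x _; rewrite opprK.
by apply: measurableT_comp => //; exact: oppr_measurable.
Qed.

Lemma ge0_integral_oppr (f : R -> \bar R) :
  measurable_fun [set: R] f -> (forall x, 0 <= f x)%E ->
  (\int[mu]_x f (- x)%R = \int[mu]_x f x)%E.
Proof.
move=> mf f0.
rewrite !ge0_integral_halves // 1?addeC.
  by under [X in (X + _)%E = _]eq_integral do rewrite opprK.
by apply: measurableT_comp => //; exact: oppr_measurable.
Qed.

(** The positive part at [x] is the negative part at [- x], so the two integrals cancel;
    integrability makes them finite. *)
Lemma integral_odd (f : R -> R) : mu.-integrable [set: R] (EFin \o f) ->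
  (forall x, f (- x) = - f x) -> (\int[mu]_x (f x)%:E)%E = 0%E.
Proof.
move=> intf fN; have mF := measurable_int _ intf.
rewrite integralE.
rewrite -(@ge0_integral_oppr (EFin \o f)^\-%E); last 2 first.
- exact: measurable_funeneg.
- by move=> x; exact: funeneg_ge0.
rewrite [X in (_ - X)%E](_ : _ = \int[mu]_x (EFin \o f)^\+ x)%E.
  by rewrite subee //; exact: integrable_pos_fin_num.
by apply: eq_integral => x _; rewrite funenegE funeposE /= fN opprK.
Qed.

(* Tonelli, after writing [1 / x^2] as the integral of [s e^{-s x}] over [s >= 0]. *)
Lemma integral0y_1Bcos a :
  (\int[mu]_(x in `[0%R, +oo[) ((1 - cos (a * x)) / x ^+ 2)%:E =
  (`|a| * (pi / 2))%:E)%E.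
Proof.
wlog a0 : a / 0 < a.
  move=> H; have [a0|a0|->] := ltgtP a 0.
  - rewrite -normrN -H ?oppr_gt0 //; apply: eq_integral => x _.
    by rewrite mulNr cosN.
  - exact: H.
  - rewrite normr0 mul0r; apply: integral0_eq => x _.
    by rewrite mul0r cos0 subrr mul0r.
rewrite gtr0_norm //.
pose P := `[0%R, +oo[%classic : set R.
pose Q := `]0%R, +oo[%classic : set R.
pose h (z : R * R) := (\1_P z.1 * \1_Q z.2 *
   ((1 - cos (a * z.1)) * (z.2 * expR (- (z.1 * z.2)))))%:E.
have mP : measurable (P : set (measurableTypeR R)) by exact: measurable_itv.
have mQ : measurable (Q : set (measurableTypeR R)) by exact: measurable_itv.
have h0 z : (0 <= h z)%E.
  rewrite lee_fin /h !indicE; case: (boolP (z.2 \in Q)) => [|_]; last by rewrite mulr0 mul0r.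
  rewrite inE /Q /= in_itv /= andbT => z0.
  apply: mulr_ge0; first exact: mulr_ge0.
  apply: mulr_ge0; first by rewrite subr_ge0 cos_le1.
  by apply: mulr_ge0; rewrite ?expR_ge0 // ltW.
have mh : measurable_fun setT h.
  apply/measurable_EFinP.
  apply: measurable_funM.
    apply: measurable_funM.
      exact: (measurableT_comp (measurable_indic mP) measurable_fst).
    exact: (measurableT_comp (measurable_indic mQ) measurable_snd).
  apply: measurable_funM.
    apply: measurable_funB => //.
    apply: measurableT_comp; first exact: measurable_cos.
    by apply: measurable_funM.
  apply: measurable_funM => //.
  apply: measurableT_comp; first exact: measurable_expR.
  apply: measurableT_comp; first exact: oppr_measurable.
  exact: measurable_funM.
have := @fubini_tonelli _ _ _ _ _ mu mu h mh h0.
have indE (A : set R) (f : R -> R) : (fun x => (\1_A x * f x)%:E) = (EFin \o f) \_ A.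
  apply/funext => x; rewrite patchE indicE; case: ifP; by rewrite ?mul1r ?mul0r.
have -> : (\int[mu]_x \int[mu]_y h (x, y) =
   \int[mu]_(x in `[0%R, +oo[) ((1 - cos (a * x)) / x ^+ 2)%:E)%E.
  rewrite [RHS]integral_mkcond; apply: eq_integral => x _.
  rewrite -[in RHS](indE _ (fun x => (1 - cos (a * x)) / x ^+ 2)).
  rewrite /h /=.
  transitivity (\int[mu]_y ((\1_P x * (1 - cos (a * x)))%:E *
      (\1_Q y * (y * expR (- (x * y))))%:E))%E.
    by apply: eq_integral => y _; rewrite -EFinM; congr EFin; ring.
  rewrite ge0_integralZl //; last 2 first.
  - apply/measurable_EFinP; apply: measurable_funM => //; apply: measurable_funM => //.
    exact: measurable_expRN_M.
  - move=> y _; rewrite lee_fin indicE; case: (boolP (y \in Q)) => [|_]; last by rewrite mul0r.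
    by rewrite inE /Q /= in_itv /= andbT => y0; rewrite mul1r mulr_ge0 ?expR_ge0 ?ltW.
  rewrite indicE mem_setE in_itv /= andbT.
  (* At [x = 0] the integral in [s] diverges, but its factor [1 - cos (a x)] is 0 and the product is
     0, as is the right-hand side with its division by zero. *)
  have [->|xn0] := eqVneq x 0.
    by rewrite mulr0 cos0 subrr mulr0 mul0r mulr0 mul0e.
  case: leP => [x0|_]; last by rewrite !mul0r mul0e.
  have {xn0}x0 : 0 < x by rewrite lt_neqAle eq_sym xn0.
  rewrite !mul1r (indE Q (fun y => y * expR (- (x * y)))) -integral_mkcond.
  rewrite integral_itv_obnd_cbnd; last first.
    apply: measurable_funTS; apply/measurable_EFinP; apply: measurable_funM => //.
    exact: measurable_expRN_M.
  by rewrite integral_id_expR.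
move=> ->.
transitivity (\int[mu]_(y in Q) (a ^+ 2 / (y ^+ 2 + a ^+ 2))%:E)%E.
  rewrite [RHS]integral_mkcond; apply: eq_integral => y _.
  rewrite -[in RHS](indE _ (fun y => (a ^+ 2 / (y ^+ 2 + a ^+ 2)))).
  rewrite /h /=; rewrite indicE mem_setE in_itv /= andbT.
  case: ltP => [y0|_]; last first.
    by rewrite mul0r; apply: integral0_eq => x _; rewrite mulr0 mul0r.
  transitivity (\int[mu]_x (y%:E *
      (\1_P x * (expR (- (y * x)) * (1 - cos (a * x))))%:E))%E.
    apply: eq_integral => x _; rewrite -EFinM; congr EFin.
    by rewrite /= (mulrC y x) mulr1 [RHS]mulrCA; congr (_ * _); ring.
  rewrite ge0_integralZl //; last 2 first.
  - apply/measurable_EFinP; apply: measurable_funM => //; apply: measurable_funM => //.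
      exact: measurable_expRN_M.
    by apply: measurable_funB => //; apply: measurableT_comp;
      [exact: measurable_cos|exact: measurable_funM].
  - by rewrite lee_fin ltW.
  rewrite (indE P (fun x => expR (- (y * x)) * (1 - cos (a * x)))) -integral_mkcond.
  (* The factor [s] turns the Laplace transform [1/s - s / (s^2 + a^2)] into [a^2 / (s^2 + a^2)]. *)
  rewrite integral_expR_1Bcos // -EFinM mul1r; congr EFin; field.
  by rewrite !gt_eqF // ltr_pwDl ?sqr_ge0 ?exprn_gt0.
rewrite integral_itv_obnd_cbnd ?integral_poisson //.
apply: measurable_funTS; apply/measurable_EFinP; apply: measurable_funM => //.
apply: continuous_measurable_fun => s; apply: cvgV.
  by rewrite gt_eqF // ltr_wpDl ?sqr_ge0 ?exprn_gt0.
by apply: cvgD; [exact: exprn_continuous|exact: cvg_cst].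
Qed.

Lemma norm_sin_le x : `|sin x| <= `|x|.
Proof.
wlog x0 : x / 0 < x.
  move=> H; have [x0|x0|->] := ltgtP x 0; last by rewrite sin0 normr0.
    by rewrite -[x in sin x]opprK sinN normrN -[leRHS]normrN H // oppr_gt0.
  exact: H.
have [c _] := @MVT R sin cos 0 x x0 (fun x _ => is_derive_sin x)
  (continuous_subspaceT (@continuous_sin R)).
rewrite sin0 !subr0 => ->; rewrite normrM ler_piMl //.
by rewrite ler_norml cos_geN1 cos_le1.
Qed.

(** From [cos x = 1 - 2 sin^2 (x/2)] and [|sin| <= |id|]. It gives both [fejer <= 1] and the
    coherence bound [cos >= 1/2]. *)
Lemma cos_lower_bound x : 1 - x ^+ 2 / 2 <= cos x.
Proof.
have -> : cos x = cos ((x / 2) *+ 2) by congr cos; rewrite -[RHS]mulr_natr; field.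
rewrite cos_mulr2n cos2sin2.
have : sin (x / 2) ^+ 2 <= (x / 2) ^+ 2.
  rewrite -[leLHS]real_normK ?num_real // -[leRHS]real_normK ?num_real //.
  by rewrite lerXn2r ?nnegrE // norm_sin_le.
rewrite [(1 - _) *+ 2]mulr2n; lra.
Qed.

Lemma cos_ge_half x : `|x| <= 1 -> 2^-1 <= cos x.
Proof.
move=> x1; apply: le_trans (cos_lower_bound x).
have : x ^+ 2 <= 1 by rewrite -real_normK ?num_real // expr_le1.
lra.
Qed.

(** The inverse of a nonnegative number is its power of exponent [-1], also at 0, and powers are
    measurable. *)
Lemma measurable_sqrV (f : R -> R) : measurable_fun [set: R] f ->
  measurable_fun [set: R] (fun x => (f x ^+ 2)^-1).
Proof.
move=> mf; rewrite (_ : (fun x => _) = @powR R ^~ (-1) \o (fun x => f x ^+ 2)).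
  by apply: measurableT_comp => //; exact: measurable_funX.
by apply/funext => x /=; rewrite powR_inv1 ?sqr_ge0.
Qed.

(** The integral of [k a] over the line is [pi |a|]; combinations of these kernels therefore
    integrate to combinations of absolute values, here to the tent. *)
Let k a x : R := (1 - cos (a * x)) / x ^+ 2.

Let mk a : measurable_fun [set: R] (k a).
Proof.
apply: measurable_funM.
  by apply: measurable_funB => //; apply: measurableT_comp;
    [exact: measurable_cos|exact: measurable_funM].
exact: measurable_sqrV.
Qed.

Let k_ge0 a x : 0 <= k a x.
Proof. by rewrite /k mulr_ge0 ?invr_ge0 ?sqr_ge0 // subr_ge0 cos_le1. Qed.

Let integral_k a : (\int[mu]_x (k a x)%:E = (pi * `|a|)%:E)%E.
Proof.
rewrite ge0_integral_halves; last 2 first.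
- exact/measurable_EFinP.
- by move=> x; rewrite lee_fin.
under [X in (_ + X)%E]eq_integral do rewrite /k mulrN cosN sqrrN.
rewrite integral0y_1Bcos -EFinD; congr EFin; by field.
Qed.

Let integrable_k a : mu.-integrable [set: R] (EFin \o k a).
Proof.
apply/integrableP; split; first (apply/measurable_EFinP; exact: mk).
under eq_integral do rewrite /= ger0_norm //.
by rewrite integral_k ltry.
Qed.

Definition tent (y : R) : R := Num.max 0 (1 - `|y|).

Lemma tent_ge0 (y : R) : 0 <= tent y. Proof. by rewrite /tent le_max lexx. Qed.

Lemma tent_le1 (y : R) : tent y <= 1.
Proof. by rewrite /tent ge_max ler01 gerBl normr_ge0. Qed.

Lemma tent_eq0 (y : R) : 1 <= `|y| -> tent y = 0.
Proof. by move=> y1; rewrite /tent; apply/max_idPl; rewrite subr_le0. Qed.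

(** The tent is half the second difference of the absolute value with step 1, the form in which
    integrals of [k] produce it. *)
Lemma tentE (y : R) : tent y = (`|1 + y| + `|1 - y|) / 2 - `|y|.
Proof.
rewrite /tent; case: (ger0P y) => y0; case: (ger0P (1 + y)) => y1;
  case: (ger0P (1 - y)) => y2; first [lra | rewrite maxEle; case: (leP 0 _); lra].
Qed.

(* The value at [x = 0] is [0] (division by zero) instead of [1]. *)
Definition fejer b x : R := 2 * (1 - cos (b * x)) / (b * x) ^+ 2.

Lemma fejer_ge0 b x : 0 <= fejer b x.
Proof. by rewrite /fejer !mulr_ge0 ?invr_ge0 ?sqr_ge0 // subr_ge0 cos_le1. Qed.

Lemma fejer_le1 b x : fejer b x <= 1.
Proof.
rewrite /fejer; have [->|h] := eqVneq (b * x) 0.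
  by rewrite expr0n /= invr0 mulr0.
rewrite ler_pdivrMr ?mul1r; last by rewrite exprn_even_gt0.
have := cos_lower_bound (b * x); lra.
Qed.

Lemma fejerE b x : b != 0 -> fejer b x = 2 / b ^+ 2 * k b x.
Proof.
move=> b0; rewrite /fejer /k exprMn invfM; ring.
Qed.

Lemma measurable_fejer b : measurable_fun [set: R] (fejer b).
Proof.
apply: measurable_funM.
  apply: measurable_funM => //.
  by apply: measurable_funB => //; apply: measurableT_comp;
    [exact: measurable_cos|exact: measurable_funM].
by apply: measurable_sqrV; exact: measurable_funM.
Qed.

(** By the addition formulas, [2 (1 - cos bx) cos yx] is the second difference with step [b], in the
    frequency [y], of [1 - cos yx]. *)
Let fejer_cosE b y x : b != 0 ->
  fejer b x * cos (y * x) = b ^- 2 * (k (b + y) x + k (b - y) x - 2 * k y x).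
Proof.
move=> b0; rewrite fejerE // /k (mulrDl b y x) (mulrBl x b y) cosD cosB.
ring.
Qed.

Lemma integrable_fejer_cos b y : b != 0 ->
  mu.-integrable [set: R] (EFin \o (fun x => fejer b x * cos (y * x))).
Proof.
move=> b0.
rewrite (_ : EFin \o _ = (fun x => (b ^- 2)%:E *
    ((k (b + y) x)%:E + (k (b - y) x)%:E - 2%:E * (k y x)%:E))%E); last first.
  by apply/funext => x /=; rewrite fejer_cosE.
apply: integrableZl => //; apply: integrableB => //.
  by apply: integrableD => //; exact: integrable_k.
by apply: integrableZl => //; exact: integrable_k.
Qed.

(** The three integrals [pi |b + y|], [pi |b - y|] and [pi |y|] combine as in [tentE], after scaling
    by [b]. *)
Lemma integral_fejer_cos b y : 0 < b ->
  \int[mu]_x (fejer b x * cos (y * x)) = 2 * pi / b * tent (y / b).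
Proof.
move=> b0; have bn0 : b != 0 by rewrite gt_eqF.
under eq_Rintegral do rewrite fejer_cosE //.
have ik a := @integrable_k a.
have ik2 a c : mu.-integrable [set: R] (EFin \o (fun x => k a x + k c x)).
  rewrite (_ : EFin \o _ = ((EFin \o k a) \+ (EFin \o k c))%E) //; exact: integrableD.
have ik3 c : mu.-integrable [set: R] (EFin \o (fun x => 2 * k c x)).
  rewrite (_ : EFin \o _ = (fun x => 2%:E * (EFin \o k c) x)%E) //; exact: integrableZl.
rewrite RintegralZl //; last first.
  rewrite (_ : EFin \o _ = ((EFin \o (fun x => k (b + y) x + k (b - y) x)%R) \-
    (EFin \o (fun x => 2 * k y x)%R))%E) //.
  exact: integrableB.
rewrite RintegralB // RintegralD // RintegralZl //.
rewrite /Rintegral !integral_k /= tentE.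
have E z : `|z / b| = `|z| / b by rewrite normrM normfV (gtr0_norm b0).
have -> : 1 + y / b = (b + y) / b by field.
have -> : 1 - y / b = (b - y) / b by field.
rewrite !E; field.
exact: bn0.
Qed.

Lemma integrable_fejer b : b != 0 -> mu.-integrable [set: R] (EFin \o fejer b).
Proof.
move=> b0; have := @integrable_fejer_cos b 0 b0.
by rewrite (_ : (fun x => _) = fejer b) //; apply/funext => x; rewrite mul0r cos0 mulr1.
Qed.

Lemma integrable_fejer_sin b y : b != 0 ->
  mu.-integrable [set: R] (EFin \o (fun x => fejer b x * sin (y * x))).
Proof.
move=> b0; apply: (le_integrable _ _ _ (integrable_fejer b0)) => //.
  apply/measurable_EFinP; apply: measurable_funM; first exact: measurable_fejer.
  by apply: measurableT_comp; [exact: measurable_sin|exact: measurable_funM].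
move=> x _; rewrite /= lee_fin normrM ler_piMr //.
exact: sin_max.
Qed.

Lemma integral_fejer_sin b y : b != 0 -> \int[mu]_x (fejer b x * sin (y * x)) = 0.
Proof.
move=> b0; rewrite /Rintegral integral_odd //; first exact: integrable_fejer_sin.
by move=> x; rewrite /fejer !mulrN cosN sqrrN sinN mulrN.
Qed.

End fejer.

(** * Integration of tensor products *)

Section tensor.
Context {R : realType}.
Local Notation mu := (@lebesgue_measure R).

Lemma measurable_box n (A : 'I_n -> set (measurableTypeR R)) :
  (forall i, measurable (A i)) ->
  measurable [set x : Rn R n | forall i, A i (tnth x i)].
Proof.
move=> mA.
rewrite (_ : [set x | _] = \bigcap_(i in [set: 'I_n])
    ((@tnth n (measurableTypeR R) ^~ i) @^-1` A i)); last first.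
  by apply/seteqP; split=> x H i; [move=> _; exact: H | exact: H].
apply: fin_bigcap_measurable; first exact: finite_finset.
move=> i _; rewrite -[X in measurable X]setTI.
exact: measurable_tnth.
Qed.

Lemma sigma_finite_lebesgue_rn n : sigma_finite setT (lebesgue_rn R n).
Proof.
exists (fun k => [set x : Rn R n | forall i, (tnth x i : R) \in `[- k%:R, k%:R] ]).
  apply/seteqP; split => // x _.
  pose r := \sum_(i < n) `|tnth x i|.
  exists (Num.trunc r).+1 => // i.
  have xr : `|tnth x i| <= r.
    by rewrite /r (bigD1 i) //= lerDl sumr_ge0.
  rewrite /= in_itv /= -ler_norml (le_trans xr) // ltW //.
  exact: truncnS_gt.
move=> k; split.
  apply: (@measurable_box n (fun=> `[- k%:R, k%:R]%classic)) => i; exact: measurable_itv.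
rewrite (@lebesgue_rn_box R n (fun=> `[- k%:R, k%:R]%classic)); last first.
  by move=> i; exact: measurable_itv.
suff : (\prod_(i < n) mu `[(- k%:R)%R, k%:R%R]%classic)%E \is a fin_num.
  by rewrite fin_numElt => /andP[].
elim/big_ind: _ => [//|x y|i _]; first exact: fin_numM.
by rewrite lebesgue_measure_itv /=; case: ifP.
Qed.

(** Tonelli and Fubini are stated for bundled sigma-finite measures, while [lebesgue_rn] is built as
    a plain measure; this lemma packs the proof of sigma-finiteness into the structure. *)
Lemma sigma_finite_measureE d (T : measurableType d) (m : {measure set T -> \bar R}) :
  sigma_finite setT m ->
  exists m' : {sigma_finite_measure set T -> \bar R}, m = m' :> {measure set T -> \bar R}.
Proof.
move=> sfm.
pose H2 := isSFinite.Build _ _ _ (Measure.sort m) (sfinite_measure_sigma_finite sfm).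
pose H3 := isSigmaFinite.Build _ _ _ (Measure.sort m) sfm.
pose m' := HB.pack_for (SigmaFiniteMeasure.type T R) (Measure.sort m) H2 H3.
by exists m'; exact: eq_measure.
Qed.

Section step.
Context n (m : {sigma_finite_measure set (Rn R n) -> \bar R}).

(** The measure is the image of a product measure under [rn_cons]: change variables, then apply
    Tonelli. Every tuple is the [rn_cons] of its tail and head, so the values of [f] on [rn_cons]
    determine it. *)
Lemma ge0_integral_step (u : Rn R n -> R) (v : R -> R) (f : Rn R n.+1 -> R) :
  measurable_fun setT u -> measurable_fun [set: R] v ->
  (forall x, 0 <= u x) -> (forall x, 0 <= v x) ->
  measurable_fun setT f -> (forall x y, f (rn_cons (x, y)) = u x * v y) ->
  (\int[lebesgue_rn_step m]_x (f x)%:E =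
   (\int[m]_x (u x)%:E) * \int[mu]_y (v y)%:E)%E.
Proof.
move=> mu_ mv u0 v0 mf fE.
have f0 x : 0 <= f x.
  have -> : x = rn_cons ([tuple of behead x], thead x).
    by apply/val_inj; rewrite [in LHS](tuple_eta x).
  by rewrite fE mulr_ge0.
have mf' : measurable_fun setT (EFin \o f) by exact/measurable_EFinP.
have f0' : {in setT, forall x, 0 <= (f x)%:E}%E by move=> x _; rewrite lee_fin.
rewrite (ge0_integral_pushforward (@measurable_rn_cons R n) (m \x mu)%E measurableT mf' f0').
rewrite preimage_setT.
have mfc := measurableT_comp mf' (@measurable_rn_cons R n).
rewrite (@fubini_tonelli1 _ _ _ _ _ m mu _ mfc) /fubini_F /=; last by move=> z; rewrite lee_fin.
have mvE : measurable_fun [set: R] (EFin \o v) by exact/measurable_EFinP.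
have muE : measurable_fun setT (EFin \o u) by exact/measurable_EFinP.
have E x : (\int[mu]_y (f (rn_cons (x, y)))%:E = (u x)%:E * \int[mu]_y (v y)%:E)%E.
  under eq_integral do rewrite fE EFinM.
  rewrite (@ge0_integralZl _ _ _ mu setT measurableT (EFin \o v) mvE (u x)%:E) //.
    by move=> y _; rewrite lee_fin.
  by rewrite lee_fin.
under eq_integral do rewrite E.
rewrite (@ge0_integralZr _ _ _ m setT measurableT (EFin \o u) muE) //.
  by move=> x _; rewrite lee_fin.
by apply: integral_ge0 => y _; rewrite lee_fin.
Qed.


Lemma integrable_integral_step (u : Rn R n -> R) (v : R -> R) (f : Rn R n.+1 -> R) :
  m.-integrable setT (EFin \o u) -> mu.-integrable [set: R] (EFin \o v) ->
  measurable_fun setT f -> (forall x y, f (rn_cons (x, y)) = u x * v y) ->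
  (lebesgue_rn_step m).-integrable setT (EFin \o f) /\
  \int[lebesgue_rn_step m]_x f x = (\int[m]_x u x) * \int[mu]_y v y.
Proof.
move=> iu iv mf fE.
have mfE : measurable_fun setT (EFin \o f) by exact/measurable_EFinP.
have mu_ : measurable_fun setT u by apply/measurable_EFinP; exact: measurable_int iu.
have mv : measurable_fun [set: R] v by apply/measurable_EFinP; exact: measurable_int iv.
have mafE : measurable_fun setT (fun x => `|(f x)%:E|%E) by exact: measurableT_comp.
have foo : (\int[lebesgue_rn_step m]_x `|(f x)%:E| < +oo)%E.
  rewrite (@ge0_integral_step (fun x => `|u x|) (fun x => `|v x|) (fun x => `|f x|)) //.
  - apply: lte_mul_pinfty.
    + exact: integral_ge0.
    + rewrite ge0_fin_numE; last exact: integral_ge0.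
      by have /integrableP[_] := iu.
    + by have /integrableP[_] := iv.
  - exact: measurableT_comp.
  - exact: measurableT_comp.
  - exact: measurableT_comp.
  - by move=> x y; rewrite fE normrM.
split; first by apply/integrableP.
have fic : (m \x mu)%E.-integrable setT (fun z => (f (rn_cons z))%:E).
  apply/integrableP; split.
    exact: measurableT_comp mfE (@measurable_rn_cons R n).
  rewrite ge0_integral_pushforward // in foo.
  exact: measurable_rn_cons.
rewrite /Rintegral (integral_pushforward (@measurable_rn_cons R n) mfE) //.
rewrite preimage_setT -(@integral12_prod_meas1 _ _ _ _ _ m mu _ fic) /fubini_F.
have E x : (\int[mu]_y (f (rn_cons (x, y)))%:E = (u x)%:E * \int[mu]_y (v y)%:E)%E.
  under eq_integral do rewrite fE EFinM.
  by rewrite (@integralZl _ _ _ mu setT measurableT (EFin \o v) iv (u x)).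
transitivity (fine (\int[m]_x ((u x)%:E * \int[mu]_y (v y)%:E))%E).
  by congr fine; apply: eq_integral => x _; exact: E.
have /fineK <- := integrable_fin_num measurableT iv.
rewrite (@integralZr _ _ _ m setT measurableT (EFin \o u) iu).
by have /fineK <- := integrable_fin_num measurableT iu.
Qed.

End step.
End tensor.

(** * Complex-valued tensor products *)

Section tensor.
Local Open Scope complex_scope.
Context {R : realType}.
Local Notation mu := (@lebesgue_measure R).

Lemma measurable_tensor n (h : 'I_n -> R -> R) :
  (forall i, measurable_fun [set: R] (h i)) ->
  measurable_fun setT (fun x : Rn R n => \prod_(i < n) h i (tnth x i)).
Proof.
move=> mh; apply: measurable_prod => i _.
exact: measurableT_comp (mh i) (@measurable_tnth _ (measurableTypeR R) n i).
Qed.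

Lemma tensor_rn_cons (A : comNzRingType) n (h : 'I_n.+1 -> R -> A) (x : Rn R n)
    (y : measurableTypeR R) :
  \prod_(i < n.+1) h i (tnth (rn_cons (x, y)) i) =
  (\prod_(i < n) h (lift ord0 i) (tnth x i)) * h ord0 y.
Proof.
rewrite big_ord_recl mulrC; congr (_ * _).
by apply: eq_bigr => i _; rewrite /rn_cons tnthS.
Qed.

Lemma ge0_integral_tensor n (h : 'I_n -> R -> R) :
  (forall i, measurable_fun [set: R] (h i)) -> (forall i x, 0 <= h i x) ->
  (\int[lebesgue_rn R n]_x (\prod_(i < n) h i (tnth x i))%:E =
   \prod_(i < n) \int[mu]_x (h i x)%:E)%E.
Proof.
elim: n h => [|n IH] h mh h0.
  rewrite big_ord0 integral_dirac //; last by apply/measurable_EFinP; exact: measurable_tensor.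
  by rewrite diracT mul1e big_ord0.
have [m mE] := sigma_finite_measureE (@sigma_finite_lebesgue_rn R n).
have IHn := IH (fun i => h (lift ord0 i)) (fun i => mh _) (fun i => h0 _).
rewrite big_ord_recl muleC -IHn /= mE.
apply: (@ge0_integral_step _ _ m (fun x => \prod_(i < n) h (lift ord0 i) (tnth x i)) (h ord0)).
- by apply: (measurable_tensor (h := fun i => h (lift ord0 i))).
- exact: mh.
- by move=> x; apply: prodr_ge0.
- exact: h0.
- exact: measurable_tensor.
- by move=> x y; rewrite tensor_rn_cons.
Qed.

Lemma complex_ReM (a b : R[i]) :
  complex.Re (a * b) = complex.Re a * complex.Re b - complex.Im a * complex.Im b.
Proof. by case: a b => [? ?] [? ?]. Qed.

Lemma complex_ImM (a b : R[i]) :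
  complex.Im (a * b) = complex.Re a * complex.Im b + complex.Im a * complex.Re b.
Proof. by case: a b => [? ?] [? ?]. Qed.

Definition cintegrable d (T : measurableType d) (m : {measure set T -> \bar R})
    (f : T -> R[i]) :=
  m.-integrable setT (fun x => (complex.Re (f x))%:E) /\
  m.-integrable setT (fun x => (complex.Im (f x))%:E).

Definition cintegral1 (f : R -> R[i]) : R[i] :=
  (\int[mu]_x complex.Re (f x)) +i* (\int[mu]_x complex.Im (f x)).

Lemma integrable_integral_tensor2 n (u : Rn R n -> R) (v : R -> R) :
  (lebesgue_rn R n).-integrable setT (EFin \o u) ->
  mu.-integrable [set: R] (EFin \o v) ->
  (lebesgue_rn R n.+1).-integrable setT
     (fun x => (u [tuple of behead x] * v (thead x))%:E) /\
  \int[lebesgue_rn R n.+1]_x (u [tuple of behead x] * v (thead x)) =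
    (\int[lebesgue_rn R n]_x u x) * \int[mu]_y v y.
Proof.
have [m mE] := sigma_finite_measureE (@sigma_finite_lebesgue_rn R n).
rewrite /= mE => iu iv.
have mu_ : measurable_fun setT u by apply/measurable_EFinP; exact: measurable_int iu.
have mv : measurable_fun [set: R] v by apply/measurable_EFinP; exact: measurable_int iv.
apply: (integrable_integral_step iu iv).
  apply: measurable_funM.
    exact: measurableT_comp mu_ (@measurable_behead _ (measurableTypeR R) n).
  exact: measurableT_comp mv (@measurable_tnth _ (measurableTypeR R) n.+1 ord0).
by move=> x y; congr (u _ * v _); apply/val_inj.
Qed.

(** Induction on [n]. Splitting off one coordinate, the complex product has four real terms (real or
    imaginary part of either factor), and Fubini applies to each. *)
Lemma cintegral_tensor n (h : 'I_n -> R -> R[i]) :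
  (forall i, cintegrable mu (h i)) ->
  cintegrable (lebesgue_rn R n) (fun x => \prod_(i < n) h i (tnth x i)) /\
  cintegral (fun x : Rn R n => \prod_(i < n) h i (tnth x i)) =
    \prod_(i < n) cintegral1 (h i).
Proof.
elim: n h => [|n IH] h ih.
  have E : (fun x : Rn R 0 => \prod_(i < 0) h i (tnth x i)) = cst 1.
    by apply/funext => x; rewrite big_ord0.
  rewrite E big_ord0 /cintegrable /cintegral /Rintegral /= !integral_dirac //.
  rewrite !diracT !mul1e; split => //.
  by split; apply/integrableP; split => //; rewrite integral_dirac // diracT mul1e ltry.
have [[iRe iIm] iE] := IH (fun i => h (lift ord0 i)) (fun i => ih _).
have [jRe jIm] := ih ord0.
set F := fun x : Rn R n => \prod_(i < n) h (lift ord0 i) (tnth x i) in iRe iIm iE.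
have [RR RRE] := integrable_integral_tensor2 iRe jRe.
have [RI RIE] := integrable_integral_tensor2 iRe jIm.
have [IR IRE] := integrable_integral_tensor2 iIm jRe.
have [II IIE] := integrable_integral_tensor2 iIm jIm.
have E : (fun x : Rn R n.+1 => \prod_(i < n.+1) h i (tnth x i)) =
    (fun x => F [tuple of behead x] * h ord0 (thead x)).
  apply/funext => x; rewrite big_ord_recl mulrC; congr (_ * _).
  apply: eq_bigr => i _; congr (h _ _).
  rewrite tnth_behead; congr (tnth x _); apply/val_inj; by rewrite /= inordK // ltnS.
rewrite E big_ord_recl mulrC -iE /cintegrable /cintegral /cintegral1.
under [X in (integrable _ _ X) /\ _]eq_fun do rewrite complex_ReM EFinB.
under [X in _ /\ (integrable _ _ X)]eq_fun do rewrite complex_ImM EFinD.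
split.
  by split; [exact: integrableB|exact: integrableD].
set H := fun x : Rn R n.+1 => F [tuple of behead x] * h ord0 (thead x).
have ReE : \int[lebesgue_rn R n.+1]_x complex.Re (H x) =
    (\int[lebesgue_rn R n]_x complex.Re (F x)) * \int[mu]_y complex.Re (h ord0 y) -
    (\int[lebesgue_rn R n]_x complex.Im (F x)) * \int[mu]_y complex.Im (h ord0 y).
  by rewrite -RRE -IIE -RintegralB //; apply: eq_Rintegral => x _; rewrite complex_ReM.
have ImE : \int[lebesgue_rn R n.+1]_x complex.Im (H x) =
    (\int[lebesgue_rn R n]_x complex.Re (F x)) * \int[mu]_y complex.Im (h ord0 y) +
    (\int[lebesgue_rn R n]_x complex.Im (F x)) * \int[mu]_y complex.Re (h ord0 y).
  by rewrite -RIE -IRE -RintegralD //; apply: eq_Rintegral => x _; rewrite complex_ImM.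
by rewrite ReE ImE.
Qed.

End tensor.

(** * Wave packets *)

Section packet.
Local Open Scope complex_scope.
Context {R : realType}.
Local Notation mu := (@lebesgue_measure R).
Local Notation normc := ComplexField.Normc.normc.
Implicit Types (b x xi : R) (N : nat) (nu : nat -> R).

Definition packet b N nu x : R[i] :=
  (fejer b x * \sum_(l < N) cos (nu l * x)) +i* (fejer b x * \sum_(l < N) sin (nu l * x)).

(** The Fourier transform of [packet], without the normalizing constant: one tent of half-width [b]
    at each frequency. *)
Definition comb b N nu xi : R := 2 * pi / b * \sum_(l < N) tent ((xi - nu l) / b).

Lemma normc_sqr (z : R[i]) : normc z ^+ 2 = complex.Re z ^+ 2 + complex.Im z ^+ 2.
Proof. by case: z => u v /=; rewrite sqr_sqrtr // addr_ge0 ?sqr_ge0. Qed.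

Lemma normc_ge0 (z : R[i]) : 0 <= normc z.
Proof. by case: z => u v /=; exact: sqrtr_ge0. Qed.

(** Modulation only translates the frequencies, so computing the Fourier transform of a packet
    reduces to integrating packets. *)
Lemma expi_packet b N nu x xi :
  expi (- (x * xi)) * packet b N nu x = packet b N (fun l => nu l - xi) x.
Proof.
have C : \sum_(l < N) cos ((nu l - xi) * x) =
    cos (x * xi) * (\sum_(l < N) cos (nu l * x)) + sin (x * xi) * \sum_(l < N) sin (nu l * x).
  rewrite !big_distrr -big_split /=; apply: eq_bigr => l _.
  by rewrite mulrBl cosB [xi * x]mulrC; ring.
have S : \sum_(l < N) sin ((nu l - xi) * x) =
    cos (x * xi) * (\sum_(l < N) sin (nu l * x)) - sin (x * xi) * \sum_(l < N) cos (nu l * x).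
  rewrite !big_distrr -sumrB /=; apply: eq_bigr => l _.
  by rewrite mulrBl sinB [xi * x]mulrC; ring.
rewrite /expi /packet cosN sinN C S; apply/eqP; rewrite eq_complex /=.
by apply/andP; split; apply/eqP; ring.
Qed.

Lemma integrable_fejer_sum b N (h : nat -> R -> R) :
  (forall l, mu.-integrable [set: R] (EFin \o (fun x => fejer b x * h l x))) ->
  mu.-integrable [set: R] (EFin \o (fun x => fejer b x * \sum_(l < N) h l x)) /\
  \int[mu]_x (fejer b x * \sum_(l < N) h l x) = \sum_(l < N) \int[mu]_x (fejer b x * h l x).
Proof.
move=> ih; elim: N => [|N [IH1 IH2]].
  under [EFin \o _]eq_fun do rewrite big_ord0 mulr0.
  under eq_Rintegral do rewrite big_ord0 mulr0.
  by rewrite big_ord0 /Rintegral integral0; split => //; exact: integrable0.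
rewrite (_ : (fun x => _) =
    (fun x => fejer b x * (\sum_(l < N) h l x) + fejer b x * h N x)); last first.
  by apply/funext => x; rewrite big_ord_recr /= mulrDr.
split; first exact: (integrableD _ IH1 (ih N)).
by rewrite RintegralD // IH2 [in RHS]big_ord_recr.
Qed.

Lemma cintegrable_packet b N nu : b != 0 -> cintegrable mu (packet b N nu).
Proof.
move=> b0; split.
  by have [] := @integrable_fejer_sum b N (fun l x => cos (nu l * x))
    (fun l => integrable_fejer_cos (nu l) b0).
by have [] := @integrable_fejer_sum b N (fun l x => sin (nu l * x))
  (fun l => integrable_fejer_sin (nu l) b0).
Qed.

Lemma cintegral1_packet b N nu : 0 < b ->
  cintegral1 (packet b N nu) = (2 * pi / b * \sum_(l < N) tent (nu l / b))%:C.
Proof.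
move=> b0; have bn0 : b != 0 by rewrite gt_eqF.
rewrite /cintegral1 /=.
have [_ ->] := @integrable_fejer_sum b N (fun l x => cos (nu l * x))
  (fun l => integrable_fejer_cos (nu l) bn0).
have [_ ->] := @integrable_fejer_sum b N (fun l x => sin (nu l * x))
  (fun l => integrable_fejer_sin (nu l) bn0).
rewrite [X in _ +i* X]big1 => [|l _]; last exact: integral_fejer_sin.
by rewrite big_distrr /=; congr (_ +i* _); apply: eq_bigr => l _; exact: integral_fejer_cos.
Qed.

Lemma tentN (y : R) : tent (- y) = tent y. Proof. by rewrite /tent normrN. Qed.

Lemma fourier_packet b N nu xi : 0 < b ->
  cintegral1 (fun x => expi (- (x * xi)) * packet b N nu x) = (comb b N nu xi)%:C.
Proof.
move=> b0; rewrite (_ : (fun x => _) = packet b N (fun l => nu l - xi)); last first.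
  by apply/funext => x; rewrite expi_packet.
rewrite cintegral1_packet // /comb; congr (_ * _)%:C.
by apply: eq_bigr => l _; rewrite -tentN -mulNr opprB.
Qed.

(* [fejer ^+ 2 <= fejer] linearizes the weight: the L^2 norm of a packet is then bounded
   with the Fourier transform of [fejer], and no Plancherel theorem is needed. *)
Lemma packet_sqr_le b N nu x : normc (packet b N nu x) ^+ 2 <=
  \sum_(l < N) (fejer b x * \sum_(k < N) cos ((nu l - nu k) * x)).
Proof.
have E : (\sum_(l < N) cos (nu l * x)) ^+ 2 + (\sum_(l < N) sin (nu l * x)) ^+ 2 =
   \sum_(l < N) \sum_(k < N) cos ((nu l - nu k) * x).
  rewrite !expr2 !big_distrl -big_split /=; apply: eq_bigr => l _.
  rewrite !big_distrr -big_split /=; apply: eq_bigr => k _.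
  by rewrite mulrBl cosB.
rewrite normc_sqr /= ![(fejer b x * _) ^+ 2]exprMn -mulrDr -big_distrr /= -E.
apply: ler_wpM2r; first by rewrite addr_ge0 ?sqr_ge0.
by rewrite expr2 ler_piMr ?fejer_ge0 ?fejer_le1.
Qed.

Lemma measurable_Re_packet b N nu :
  measurable_fun [set: R] (fun x => complex.Re (packet b N nu x)).
Proof.
apply: measurable_funM; first exact: measurable_fejer.
apply: measurable_sum => l; apply: measurableT_comp; first exact: measurable_cos.
exact: measurable_funM.
Qed.

Lemma measurable_Im_packet b N nu :
  measurable_fun [set: R] (fun x => complex.Im (packet b N nu x)).
Proof.
apply: measurable_funM; first exact: measurable_fejer.
apply: measurable_sum => l; apply: measurableT_comp; first exact: measurable_sin.
exact: measurable_funM.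
Qed.

Lemma measurable_normc_packet b N nu :
  measurable_fun [set: R] (fun x => normc (packet b N nu x)).
Proof.
rewrite (_ : (fun x => _) = Num.sqrt \o (fun x =>
    complex.Re (packet b N nu x) ^+ 2 + complex.Im (packet b N nu x) ^+ 2)) //.
apply: measurableT_comp; first by apply: continuous_measurable_fun; exact: sqrt_continuous.
apply: measurable_funD; apply: measurable_funX;
  [exact: measurable_Re_packet|exact: measurable_Im_packet].
Qed.

(** After [packet_sqr_le], the pair [l, k] contributes [tent ((nu l - nu k) / b)], which vanishes
    off the diagonal by separation. The [N] diagonal terms equal [2 pi / b] each. *)
Lemma integral_packet_sqr b N nu : 0 < b ->
  (forall l k, (l < N)%N -> (k < N)%N -> l != k -> b <= `|nu l - nu k|) ->
  (\int[mu]_x (normc (packet b N nu x) ^+ 2)%:E <= (2 * pi / b * N%:R)%:E)%E.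
Proof.
move=> b0 sep; have bn0 : b != 0 by rewrite gt_eqF.
pose T l x := fejer b x * \sum_(k < N) cos ((nu l - nu k) * x).
have TP l := @integrable_fejer_sum b N (fun k x => cos ((nu l - nu k) * x))
  (fun k => integrable_fejer_cos (nu l - nu k) bn0).
have iT l : mu.-integrable [set: R] (EFin \o T l) by have [] := TP l.
have iS : mu.-integrable [set: R] (fun x => \sum_(l < N) (T l x)%:E)%E.
  apply: (@integrable_sum _ _ _ mu setT measurableT _ _ _
    (fun (l : 'I_N) x => (T l x)%:E)) => l _; exact: iT.
apply: (@le_trans _ _ (\int[mu]_x (\sum_(l < N) (T l x)%:E)))%E.
  apply: ge0_le_integral => //.
  - by move=> x _; rewrite lee_fin sqr_ge0.
  - by apply/measurable_EFinP; apply: measurable_funX; exact: measurable_normc_packet.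
  - exact: measurable_int iS.
  - by move=> x _; rewrite sumEFin lee_fin; exact: packet_sqr_le.
rewrite (@integral_sum _ _ _ mu setT measurableT _ (fun (l : 'I_N) x => (T l x)%:E)) //.
have -> : (\sum_(l < N) \int[mu]_x (T l x)%:E = \sum_(l < N) (2 * pi / b)%:E)%E.
  apply: eq_bigr => l _.
  have /fineK <- := integrable_fin_num measurableT (iT l).
  have [_ E] := TP l; congr EFin.
  transitivity (\int[mu]_x (T l x)) => //; rewrite E (bigD1 l) //= big1 ?addr0.
    by rewrite integral_fejer_cos // subrr mul0r /tent normr0 subr0 maxEle ler01 mulr1.
  move=> k kl; rewrite integral_fejer_cos // tent_eq0 ?mulr0 //.
  by rewrite normrM normfV (gtr0_norm b0) ler_pdivlMr // mul1r sep // eq_sym.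
by rewrite sumEFin sumr_const card_ord lee_fin mulr_natr.
by move=> l; exact: iT.
Qed.

Lemma integral_packet_normc b N nu : 0 < b ->
  (\int[mu]_x (normc (packet b N nu x))%:E < +oo)%E.
Proof.
move=> b0; have bn0 : b != 0 by rewrite gt_eqF.
have [/integrableP[_ i1] /integrableP[_ i2]] := cintegrable_packet N nu bn0.
apply: (@le_lt_trans _ _ (\int[mu]_x (`|complex.Re (packet b N nu x)|%:E +
    `|complex.Im (packet b N nu x)|%:E)))%E.
  apply: ge0_le_integral => //.
  - by move=> x _; rewrite lee_fin normc_ge0.
  - by apply/measurable_EFinP; exact: measurable_normc_packet.
  - apply: emeasurable_funD; apply/measurable_EFinP; apply: measurableT_comp => //;
    [exact: measurable_Re_packet|exact: measurable_Im_packet].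
  - move=> x _; rewrite -EFinD lee_fin.
    rewrite -(@ler_pXn2r _ 2) ?nnegrE ?addr_ge0 ?normc_ge0 // normc_sqr sqrrD.
    by rewrite !real_normK ?num_real // -addrA lerD2l lerDr mulrn_wge0 // mulr_ge0.
rewrite ge0_integralD //; last 2 first.
- by apply/measurable_EFinP; apply: measurableT_comp => //; exact: measurable_Re_packet.
- by apply/measurable_EFinP; apply: measurableT_comp => //; exact: measurable_Im_packet.
exact: lte_add_pinfty.
Qed.

End packet.

(** * Size of the Fourier transforms of packets *)

Section comb.
Local Open Scope complex_scope.
Context {R : realType}.
Local Notation mu := (@lebesgue_measure R).
Implicit Types (b x xi : R) (N : nat) (nu : nat -> R).

Lemma measurable_tent (f : R -> R) : measurable_fun [set: R] f ->
  measurable_fun [set: R] (fun x => tent (f x)).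
Proof.
move=> mf; apply: measurable_maxr => //; apply: measurable_funB => //.
exact: measurableT_comp.
Qed.

Lemma measurable_comb b N nu : measurable_fun [set: R] (comb b N nu).
Proof.
apply: measurable_funM => //; apply: measurable_sum => l; apply: measurable_tent.
by apply: measurable_funM => //; exact: measurable_funB.
Qed.

Lemma comb_ge0 b N nu xi : 0 < b -> 0 <= comb b N nu xi.
Proof.
move=> b0; rewrite /comb mulr_ge0 ?divr_ge0 ?mulr_ge0 ?pi_ge0 ?(ltW b0) //.
by apply: sumr_ge0 => l _; exact: tent_ge0.
Qed.

Lemma comb_neq0 b N nu xi : 0 < b -> comb b N nu xi != 0 ->
  exists2 l, (l < N)%N & `|xi - nu l| < b.
Proof.
move=> b0; rewrite /comb mulf_eq0 negb_or => /andP[_].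
case: (pselect (exists2 l, (l < N)%N & `|xi - nu l| < b)) => // H.
rewrite big1 ?eqxx // => l _; apply: tent_eq0.
rewrite normrM normfV (gtr0_norm b0) ler_pdivlMr // mul1r leNgt.
by apply/negP => h; apply: H; exists l.
Qed.

(** The tent is at least [1/2] on the interval of radius [b/2] around [c], and at most the indicator
    of the interval of radius [b]. *)
Lemma integral_tent_bounds b (c : R) : 0 < b ->
  ((b / 2)%:E <= \int[mu]_x (tent ((x - c) / b))%:E <= (2 * b)%:E)%E.
Proof.
move=> b0.
have mt : measurable_fun [set: R] (fun x => (tent ((x - c) / b))%:E).
  apply/measurable_EFinP; apply: measurable_tent.
  by apply: measurable_funM => //; exact: measurable_funB.
have bn r : (`[c - r, c + r]%classic : set R) = [set x | `|x - c| <= r].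
  by apply/seteqP; split => x /=; rewrite in_itv /= ler_distlC -?ler_distl distrC.
have nE x : `|(x - c) / b| = `|x - c| / b by rewrite normrM normfV (gtr0_norm b0).
have iE r k : 0 < r ->
    (\int[mu]_x (k%:E * (\1_(`[(c - r)%R, (c + r)%R]%classic : set R) x)%:E) =
     (k * (r + r))%:E)%E.
  move=> r0; rewrite integralZl //; last exact: integrable_indic_itv.
  rewrite integral_indic // setIT EFinM; congr (_ * _)%E.
  have := @lebesgue_measure_itv R `[c - r, c + r]; rewrite /= => ->.
  by rewrite lte_fin ltrD2l gtrN // -EFinD; congr EFin; ring.
apply/andP; split.
- rewrite (_ : b / 2 = 2^-1 * (b / 2 + b / 2)); last by field.
  rewrite -iE; last exact: divr_gt0.
  apply: ge0_le_integral => //.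
  + by apply: emeasurable_funM => //; apply/measurable_EFinP.
  + move=> x _; rewrite -EFinM lee_fin indicE.
    case: (boolP (_ \in _)) => [|_]; last by rewrite mulr0 tent_ge0.
    rewrite inE bn /= => h; rewrite mulr1 /tent le_max; apply/orP; right.
    rewrite nE; have : `|x - c| / b <= 2^-1 by rewrite ler_pdivrMr // mulrC.
    lra.
- rewrite (_ : 2 * b = 1 * (b + b)); last by ring.
  rewrite -iE //.
  apply: ge0_le_integral => //.
  + by move=> x _; rewrite lee_fin tent_ge0.
  + by apply: emeasurable_funM => //; apply/measurable_EFinP.
  + move=> x _; rewrite -EFinM lee_fin indicE mul1r.
    case: (boolP (_ \in _)) => [_|]; first exact: tent_le1.
    rewrite notin_setE bn /= => h; rewrite tent_eq0 // nE.
    by rewrite ler_pdivlMr // mul1r ltW // ltNge; apply/negP.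
Qed.

(** The height [2 pi / b] cancels the length [b] of the tents, leaving only the number of
    frequencies. The lower bound measures the solution at a focusing point; the upper bound serves
    integrability. *)
Lemma integral_comb_bounds b N nu : 0 < b ->
  ((pi * N%:R)%:E <= \int[mu]_x (comb b N nu x)%:E <= (4 * pi * N%:R)%:E)%E.
Proof.
move=> b0.
have k0 : 0 <= 2 * pi / b by rewrite divr_ge0 ?mulr_ge0 ?pi_ge0 ?(ltW b0).
under eq_integral do rewrite EFinM -sumEFin.
have mt l : measurable_fun [set: R] (fun x => (tent ((x - nu l) / b))%:E).
  apply/measurable_EFinP; apply: measurable_tent.
  by apply: measurable_funM => //; exact: measurable_funB.
rewrite ge0_integralZl //; last 2 first.
- by apply: (@emeasurable_sum _ _ _ _ _ _ (fun (l : 'I_N) x => (tent ((x - nu l) / b))%:E)) => l; exact: mt.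
- by move=> x _; apply: sume_ge0 => l _; rewrite lee_fin tent_ge0.
rewrite ge0_integral_sum //; last by move=> l x _; rewrite lee_fin tent_ge0.
have bn0 : b != 0 by rewrite gt_eqF.
have E c : (\sum_(l < N) c%:E = (c * N%:R)%:E :> \bar R)%E.
  by rewrite sumEFin sumr_const card_ord mulr_natr.
apply/andP; split.
- rewrite (_ : pi * N%:R = 2 * pi / b * (b / 2 * N%:R)); last by field.
  rewrite (EFinM (2 * pi / b)) lee_wpmul2l ?lee_fin // -E; apply: lee_sum => l _.
  by have /andP[] := integral_tent_bounds (nu l) b0.
- rewrite (_ : 4 * pi * N%:R = 2 * pi / b * (2 * b * N%:R)); last by field.
  rewrite (EFinM (2 * pi / b)) lee_wpmul2l ?lee_fin // -E; apply: lee_sum => l _.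
  by have /andP[] := integral_tent_bounds (nu l) b0.
- by move=> l; exact: mt.
Qed.

Lemma comb_le b N nu xi : 0 < b -> comb b N nu xi <= 2 * pi / b * N%:R.
Proof.
move=> b0; rewrite /comb ler_wpM2l ?divr_ge0 ?mulr_ge0 ?pi_ge0 ?(ltW b0) //.
rewrite -[N in N%:R]card_ord -sum1_card natr_sum; apply: ler_sum => l _.
exact: tent_le1.
Qed.

Lemma integral_comb_sqr b N nu : 0 < b -> (\int[mu]_x (comb b N nu x ^+ 2)%:E < +oo)%E.
Proof.
move=> b0; pose K := 2 * pi / b * N%:R.
have mb := measurable_comb b N nu.
apply: (@le_lt_trans _ _ (\int[mu]_x (K%:E * (comb b N nu x)%:E)))%E.
  apply: ge0_le_integral => //.
  - by move=> x _; rewrite lee_fin sqr_ge0.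
  - by apply/measurable_EFinP; exact: measurable_funX.
  - by apply: emeasurable_funM => //; apply/measurable_EFinP.
  - move=> x _; rewrite -EFinM lee_fin expr2 ler_wpM2r ?comb_ge0 //; exact: comb_le.
rewrite ge0_integralZl //; last 3 first.
- exact/measurable_EFinP.
- by move=> x _; rewrite lee_fin comb_ge0.
- by rewrite lee_fin /K mulr_ge0 ?divr_ge0 ?mulr_ge0 ?pi_ge0 ?(ltW b0).
apply: lte_mul_pinfty => //.
  by rewrite lee_fin /K mulr_ge0 ?divr_ge0 ?mulr_ge0 ?pi_ge0 ?(ltW b0).
by have /andP[_ /le_lt_trans] := @integral_comb_bounds b N nu b0; apply; rewrite ltry.
Qed.

End comb.

(** * Tensor products of packets and their Fourier transforms *)

Section wave.
Local Open Scope complex_scope.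
Context {R : realType} (n : nat).
Local Notation mu := (@lebesgue_measure R).
Local Notation normc := ComplexField.Normc.normc.
Variables (b : 'I_n -> R) (N : 'I_n -> nat) (nu : 'I_n -> nat -> R).
Hypothesis b_gt0 : forall i, 0 < b i.

Definition wave (x : Rn R n) : R[i] := \prod_(i < n) packet (b i) (N i) (nu i) (tnth x i).

(** The Fourier transform of [wave]. It is real and nonnegative, so any cancellation in the
    evolution comes from the phase alone. *)
Definition wave_hat (xi : Rn R n) : R[i] :=
  (fourier_cst (R := R) (n := n) * \prod_(i < n) comb (b i) (N i) (nu i) (tnth xi i))%:C.

Let b_neq0 i : b i != 0. Proof. by rewrite gt_eqF. Qed.

Lemma fourier_cst_gt0 : 0 < fourier_cst (R := R) (n := n).
Proof. by rewrite /fourier_cst powR_gt0 // mulr_gt0 // pi_gt0. Qed.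

Lemma expiD (u v : R) : expi (u + v) = expi u * expi v.
Proof.
rewrite /expi cosD sinD; apply/eqP; rewrite eq_complex /=.
by apply/andP; split; apply/eqP; ring.
Qed.

Lemma expi_sum (I : Type) (s : seq I) (F : I -> R) :
  expi (\sum_(i <- s) F i) = \prod_(i <- s) expi (F i).
Proof. by apply: (big_morph _ expiD); rewrite /expi cos0 sin0. Qed.

Lemma fourierL1_wave xi : fourierL1 wave xi = wave_hat xi.
Proof.
rewrite /fourierL1 /wave_hat rmorphM; congr (_ * _).
pose h i x := expi (- (x * tnth xi i)) * packet (b i) (N i) (nu i) x.
have hi i : cintegrable mu (h i).
  rewrite /h (_ : (fun x => _) = packet (b i) (N i) (fun l => nu i l - tnth xi i)).
    exact: cintegrable_packet.
  by apply/funext => x; rewrite expi_packet.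
have [_ E] := cintegral_tensor hi.
rewrite (_ : (fun x => _) = (fun x => \prod_(i < n) h i (tnth x i))); last first.
  by apply/funext => x; rewrite /dot -sumrN expi_sum -big_split.
rewrite E rmorph_prod; apply: eq_bigr => i _.
by rewrite /h fourier_packet.
Qed.

Let wave_int := cintegral_tensor (fun i => cintegrable_packet (N i) (nu i) (b_neq0 i)).

Lemma measurable_Re_wave : measurable_fun setT (fun x => complex.Re (wave x)).
Proof. by apply/measurable_EFinP; have [[/measurable_int]] := wave_int. Qed.

Lemma measurable_Im_wave : measurable_fun setT (fun x => complex.Im (wave x)).
Proof. by apply/measurable_EFinP; have [[_ /measurable_int]] := wave_int. Qed.

Lemma normc_prod (I : Type) (s : seq I) (F : I -> R[i]) :
  normc (\prod_(i <- s) F i) = \prod_(i <- s) normc (F i).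
Proof.
by apply: (big_morph _ (@ComplexField.Normc.normcM R)); rewrite ComplexField.Normc.normc1.
Qed.

Lemma prode_lty (F : 'I_n -> \bar R) : (forall i, 0 <= F i < +oo)%E ->
  (\prod_(i < n) F i < +oo)%E.
Proof.
move=> h; suff : (\prod_(i < n) F i)%E \is a fin_num by rewrite fin_numElt => /andP[].
elim/big_ind: _ => // [x y|i _]; first exact: fin_numM.
by have /andP[? ?] := h i; rewrite ge0_fin_numE.
Qed.

Lemma lee_prod (F G : 'I_n -> \bar R) : (forall i, 0 <= F i <= G i)%E ->
  (\prod_(i < n) F i <= \prod_(i < n) G i)%E.
Proof.
move=> h; suff : (0 <= \prod_(i < n) F i <= \prod_(i < n) G i)%E by case/andP.
(* Nonnegativity of the left product is carried through the induction, since multiplying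
   inequalities requires it. *)
elim/big_ind2: _ => [|x y u v /andP[x0 xy] /andP[u0 uv]|i _]; last exact: h.
  by rewrite lexx lee01.
by rewrite mule_ge0 //= lee_pmul.
Qed.

Lemma cLnorm1_wave : (cLnorm 1 wave < +oo)%E.
Proof.
rewrite /cLnorm Lnorm1.
under eq_integral => x _ do rewrite abse_EFin ger0_norm ?normc_ge0 // /wave normc_prod.
rewrite (ge0_integral_tensor (h := fun i x => normc (packet (b i) (N i) (nu i) x))).
- apply: prode_lty => i; apply/andP; split; last exact: integral_packet_normc.
  by apply: integral_ge0 => x _; rewrite lee_fin normc_ge0.
- by move=> i; exact: measurable_normc_packet.
- by move=> i x; exact: normc_ge0.
Qed.

Lemma cLnorm2E (f : Rn R n -> R[i]) :
  cLnorm 2 f = ((\int[lebesgue_rn R n]_x (normc (f x) ^+ 2)%:E) `^ 2^-1)%E.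
Proof.
rewrite /cLnorm unlock /Lnorm; congr (_ `^ _)%E; apply: eq_integral => x _.
by rewrite abse_EFin ger0_norm ?normc_ge0 // poweR_EFin powR_mulrn ?normc_ge0.
Qed.

Lemma cLnorm2_wave :
  (forall i l k, (l < N i)%N -> (k < N i)%N -> l != k -> b i <= `|nu i l - nu i k|) ->
  (cLnorm 2 wave <= ((\prod_(i < n) (2 * pi / b i * (N i)%:R)) `^ 2^-1)%:E)%E.
Proof.
move=> sep; rewrite cLnorm2E -poweR_EFin; apply: gt0_ler_poweR => //.
- by rewrite in_itv /= andbC leey integral_ge0 // => x _; rewrite lee_fin sqr_ge0.
- rewrite in_itv /= andbC leey lee_fin; apply: prodr_ge0 => i _.
  by rewrite mulr_ge0 ?divr_ge0 ?mulr_ge0 ?pi_ge0 // ltW.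
under eq_integral => x _ do rewrite /wave normc_prod -prodrXl.
rewrite (ge0_integral_tensor (h := fun i x => normc (packet (b i) (N i) (nu i) x) ^+ 2)).
- rewrite -prodEFin; apply: lee_prod => i; apply/andP; split.
    by apply: integral_ge0 => x _; rewrite lee_fin sqr_ge0.
  by apply: integral_packet_sqr => //; exact: sep.
- by move=> i; apply: measurable_funX; exact: measurable_normc_packet.
- by move=> i x; exact: sqr_ge0.
Qed.
End wave.

Section enorm.
Local Open Scope complex_scope.
Context {R : realType} (n : nat).
Implicit Types (x y : Rn R n).

Lemma dotxx_ge0 x : 0 <= dot x x.
Proof. by apply: sumr_ge0 => i _; rewrite -expr2 sqr_ge0. Qed.

Lemma enorm_sqr x : enorm x ^+ 2 = dot x x.
Proof. by rewrite /enorm sqr_sqrtr // dotxx_ge0. Qed.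

Lemma normr_tnth_le_enorm x i : `|tnth x i : R| <= enorm x.
Proof.
rewrite -(@ler_pXn2r _ 2) ?nnegrE // ?sqrtr_ge0 // enorm_sqr real_normK ?num_real //.
by rewrite /dot (bigD1 i) //= -expr2 lerDl sumr_ge0 // => j _; rewrite -expr2 sqr_ge0.
Qed.

(** The square of the norm is at most [n (c / n)^2 = c^2 / n], which is strictly below [c^2] because
    [n > 1]. *)
Lemma enorm_lt x (c : R) : (1 < n)%N -> 0 < c ->
  (forall i, `|tnth x i : R| <= c / n%:R) -> enorm x < c.
Proof.
move=> n1 c0 H; have n0 : 0 < n%:R :> R by rewrite ltr0n ltnW.
rewrite -(@ltr_pXn2r _ 2) ?nnegrE ?sqrtr_ge0 ?(ltW c0) // enorm_sqr.
apply: (@le_lt_trans _ _ (\sum_(i < n) (c / n%:R) ^+ 2)).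
  apply: ler_sum => i _; rewrite -expr2 -real_normK ?num_real //.
  by rewrite lerXn2r ?nnegrE ?divr_ge0 ?(ltW c0) ?(ltW n0).
rewrite sumr_const card_ord -[(_ ^+ 2) *+ n]mulr_natr.
have -> : (c / n%:R) ^+ 2 * n%:R = c ^+ 2 / n%:R by field; rewrite gt_eqF.
by rewrite ltr_pdivrMr // ltr_pMr ?exprn_gt0 // ltr1n.
Qed.

End enorm.

(** * The waves are admissible data *)

Section wave.
Local Open Scope complex_scope.
Context {R : realType} (n : nat).
Local Notation normc := ComplexField.Normc.normc.
Variables (b : 'I_n -> R) (N : 'I_n -> nat) (nu : 'I_n -> nat -> R).
Hypothesis b_gt0 : forall i, 0 < b i.
Hypothesis sep : forall i l k, (l < N i)%N -> (k < N i)%N -> l != k ->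
  b i <= `|nu i l - nu i k|.

Local Notation f := (wave b N nu).
Local Notation g := (wave_hat b N nu).

Lemma measurable_wave_hat : measurable_fun setT (fun xi => complex.Re (g xi)).
Proof.
apply: measurable_funM => //.
by apply: (measurable_tensor (h := fun i => comb (b i) (N i) (nu i))) => i; exact: measurable_comb.
Qed.

Lemma inLp1_wave : inLp 1 f.
Proof. by split; [exact: measurable_Re_wave|exact: measurable_Im_wave|exact: cLnorm1_wave]. Qed.

Lemma inLp2_wave : inLp 2 f.
Proof.
split; [exact: measurable_Re_wave|exact: measurable_Im_wave|].
exact: le_lt_trans (cLnorm2_wave b_gt0 sep) (ltry _).
Qed.

Lemma inLp2_wave_hat : inLp 2 g.
Proof.
split; first exact: measurable_wave_hat.
  by rewrite /wave_hat /=; exact: measurable_cst.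
rewrite cLnorm2E; apply: poweR_lty.
under eq_integral => xi _ do rewrite normc_sqr /= expr0n addr0 exprMn EFinM -prodrXl.
rewrite ge0_integralZl //; last 3 first.
- apply/measurable_EFinP.
  apply: (measurable_tensor (h := fun i x => comb (b i) (N i) (nu i) x ^+ 2)) => i.
  by apply: measurable_funX; exact: measurable_comb.
- by move=> x _; rewrite lee_fin; apply: prodr_ge0 => i _; exact: sqr_ge0.
- by rewrite lee_fin sqr_ge0.
apply: lte_mul_pinfty => //; first by rewrite lee_fin sqr_ge0.
rewrite (ge0_integral_tensor (h := fun i x => comb (b i) (N i) (nu i) x ^+ 2)).
- apply: prode_lty => i; rewrite integral_comb_sqr // andbT.
  by apply: integral_ge0 => x _; rewrite lee_fin sqr_ge0.
- by move=> i; apply: measurable_funX; exact: measurable_comb.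
- by move=> i x; exact: sqr_ge0.
Qed.

Lemma cLnorm2_0 : cLnorm 2 (fun _ : Rn R n => 0 : R[i]) = 0%E :> \bar R.
Proof.
rewrite cLnorm2E; under eq_integral do rewrite ComplexField.Normc.normc0 expr0n.
by rewrite integral0 poweR0r // invr_eq0.
Qed.

(** The wave lies in both [L^1] and [L^2], so the constant sequence is an admissible approximation
    and the Fourier integral is exactly [wave_hat]. *)
Lemma is_fourier_wave : is_fourier f g.
Proof.
split; [exact: inLp2_wave|exact: inLp2_wave_hat|].
exists (fun=> f); split.
- by move=> _; split; [exact: inLp1_wave|exact: inLp2_wave].
- have -> : (fun x => f x - f x) = fun=> 0 by apply/funext => x; rewrite subrr.
  by rewrite cLnorm2_0; exact: cvg_cst.
- have -> : (fun xi => fourierL1 f xi - g xi) = fun=> 0.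
    by apply/funext => xi; rewrite fourierL1_wave // subrr.
  by rewrite cLnorm2_0; exact: cvg_cst.
Qed.

Lemma wave_hat_neq0 xi : g xi != 0 ->
  forall i, exists2 l, (l < N i)%N & `|tnth xi i - nu i l| < b i.
Proof.
move=> gn i; apply: comb_neq0 => //; apply: contra_neq gn => h.
by rewrite /wave_hat (bigD1 i) //= h mul0r mulr0.
Qed.

(** If some [|xi_i| > 1/n], then [wave_hat] vanishes on the ball of radius [1/(2n)] around [xi],
    because its nonzero values have [|eta_i| < 1/(2n)]. Hence every coordinate of a support point is
    at most [1/n] in size. *)
Lemma ess_support_wave_hat : (1 < n)%N ->
  (forall i l, (l < N i)%N -> `|nu i l| + b i <= (2 * n%:R)^-1) ->
  ess_support g `<=` eball (@origin R n) 1.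
Proof.
move=> n1 supp xi /= xiS; rewrite /eball /=.
have n0 : 0 < n%:R :> R by rewrite ltr0n ltnW.
apply: enorm_lt => // i; rewrite tnth_mktuple tnth_mktuple subr0 div1r.
rewrite leNgt; apply/negP => xi_i.
apply: (xiS (2 * n%:R)^-1); first by rewrite invr_gt0 mulr_gt0.
apply: aeW => eta; rewrite /eball /= => h.
apply/eqP; apply: contraTT xi_i => /wave_hat_neq0 /(_ i) [l lN etal].
have := normr_tnth_le_enorm [tuple tnth eta i - tnth xi i | i < n] i.
rewrite tnth_mktuple => h2; have := le_lt_trans h2 h.
have := supp i l lN; rewrite -leNgt.
have -> : n%:R^-1 = (2 * n%:R)^-1 + (2 * n%:R)^-1 :> R by field; rewrite gt_eqF.
move=> h3 h4; have := ler_normD (nu i l) (tnth eta i - nu i l); rewrite subrKC => h5.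
have := ler_distD (tnth eta i : R) (tnth xi i : R) 0; rewrite !subr0 distrC.
lra.
Qed.
End wave.

(** * Lower bounds for coherent waves *)

Section lower.
Local Open Scope complex_scope.
Context {R : realType} (n : nat).
Local Notation normc := ComplexField.Normc.normc.
Local Notation cst_ := (fourier_cst (R := R) (n := n)).

(** The left side is the real part of [a + ic] rotated by the angle [- th]; the inequality is
    Cauchy-Schwarz, via the Lagrange identity. *)
Lemma normc_ge_rot (a c th : R) : a * cos th + c * sin th <= normc (a +i* c).
Proof.
rewrite /= ; apply: le_trans (ler_norm _) _.
rewrite -sqrtr_sqr; apply: ler_wsqrtr.
have := cos2Dsin2 th; set u := cos th; set v := sin th => uv.
rewrite -[leRHS]mulr1 -uv -subr_ge0.
have -> : (a ^+ 2 + c ^+ 2) * (u ^+ 2 + v ^+ 2) - (a * u + c * v) ^+ 2 =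
  (a * v - c * u) ^+ 2 by ring.
exact: sqr_ge0.
Qed.

Lemma measurable_phase (x : Rn R n) (t th : R) :
  measurable_fun setT (fun xi : Rn R n => dot x xi + t * enorm xi ^+ 2 - th).
Proof.
apply: measurable_funB => //; apply: measurable_funD.
  apply: measurable_sum => i; apply: measurable_funM => //.
  exact: (@measurable_tnth _ (measurableTypeR R)).
apply: measurable_funM => //.
under eq_fun do rewrite enorm_sqr.
apply: measurable_sum => i; apply: measurable_funM;
  exact: (@measurable_tnth _ (measurableTypeR R)).
Qed.

Variables (b : 'I_n -> R) (N : 'I_n -> nat) (nu : 'I_n -> nat -> R).
Hypothesis b_gt0 : forall i, 0 < b i.
Local Notation g := (wave_hat b N nu).
Let G (xi : Rn R n) := cst_ * \prod_(i < n) comb (b i) (N i) (nu i) (tnth xi i).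

Let G_ge0 xi : 0 <= G xi.
Proof.
apply: mulr_ge0; first by rewrite ltW // fourier_cst_gt0.
by apply: prodr_ge0 => i _; exact: comb_ge0.
Qed.

Let mG : measurable_fun setT G. Proof. exact: measurable_wave_hat. Qed.

Let intG : (\int[lebesgue_rn R n]_xi (G xi)%:E = cst_%:E *
   \prod_(i < n) \int[lebesgue_measure]_x (comb (b i) (N i) (nu i) x)%:E)%E.
Proof.
under eq_integral do rewrite EFinM.
rewrite ge0_integralZl //; last 3 first.
- apply/measurable_EFinP; apply: (measurable_tensor (h := fun i => comb (b i) (N i) (nu i))).
  by move=> i; exact: measurable_comb.
- by move=> x _; rewrite lee_fin; apply: prodr_ge0 => i _; exact: comb_ge0.
- by rewrite lee_fin ltW // fourier_cst_gt0.
rewrite (ge0_integral_tensor (h := fun i => comb (b i) (N i) (nu i))) //.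
  by move=> i; exact: measurable_comb.
by move=> i x; exact: comb_ge0.
Qed.

Let intG_lty : (\int[lebesgue_rn R n]_xi (G xi)%:E < +oo)%E.
Proof.
rewrite intG; apply: lte_mul_pinfty => //.
  by rewrite lee_fin ltW // fourier_cst_gt0.
apply: prode_lty => i; apply/andP; split.
  by apply: integral_ge0 => x _; rewrite lee_fin comb_ge0.
have /andP[_ /le_lt_trans] := @integral_comb_bounds _ (b i) (N i) (nu i) (b_gt0 i).
by apply; rewrite ltry.
Qed.

Let intG_ge : ((cst_ * \prod_(i < n) (pi * (N i)%:R))%:E <=
  \int[lebesgue_rn R n]_xi (G xi)%:E)%E.
Proof.
rewrite intG (EFinM cst_) -prodEFin; apply: lee_wpmul2l.
  by rewrite lee_fin ltW // fourier_cst_gt0.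
apply: lee_prod => i; apply/andP; split.
  by rewrite lee_fin mulr_ge0 // pi_ge0.
by have /andP[] := @integral_comb_bounds _ (b i) (N i) (nu i) (b_gt0 i).
Qed.

Let iG (c : Rn R n -> R) : measurable_fun setT c -> (forall x, `|c x| <= 1) ->
  (lebesgue_rn R n).-integrable setT (fun x => (c x * G x)%:E).
Proof.
move=> mc c1.
have iG1 : (lebesgue_rn R n).-integrable setT (EFin \o G).
  apply/integrableP; split; first exact/measurable_EFinP.
  by under eq_integral do rewrite /= ger0_norm //.
apply: (le_integrable _ _ _ iG1) => //.
  by apply/measurable_EFinP; exact: measurable_funM.
by move=> x _; rewrite /= lee_fin normrM ler_piMl.
Qed.

(** After rotation by [- th] the real part of the integrand is [cos (phase - th)] times the
    nonnegative transform, hence at least half of the latter. One factor [fourier_cst] comes from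
    the evolution, the other from [wave_hat]. *)
Lemma schrodinger_ge (x : Rn R n) (t th : R) :
  (forall xi, g xi != 0 -> 2^-1 <= cos (dot x xi + t * enorm xi ^+ 2 - th)) ->
  cst_ ^+ 2 / 2 * \prod_(i < n) (pi * (N i)%:R) <= normc (schrodinger g t x).
Proof.
move=> H.
pose psi xi := dot x xi + t * enorm xi ^+ 2.
have mpsi a : measurable_fun setT (fun xi => psi xi - a) by exact: measurable_phase.
have mpsi0 : measurable_fun setT psi.
  by rewrite (_ : psi = fun xi => psi xi - 0) //; apply/funext => y; rewrite subr0.
have icos := iG (measurableT_comp (@measurable_cos R) mpsi0) _.
have isin := iG (measurableT_comp (@measurable_sin R) mpsi0) _.
have icosth := iG (measurableT_comp (@measurable_cos R) (mpsi th)) _.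
have cos1 y : `|cos y : R| <= 1 by rewrite ler_norml cos_geN1 cos_le1.
have sin1 y : `|sin y : R| <= 1 by rewrite ler_norml sin_geN1 sin_le1.
have {}icos := icos (fun y => cos1 _).
have {}isin := isin (fun y => sin1 _).
have {}icosth := icosth (fun y => cos1 _).
have cst0 := @fourier_cst_gt0 R n.
rewrite /schrodinger ComplexField.Normc.normcM.
have -> : normc cst_%:C = cst_ by rewrite /= expr0n addr0 sqrtr_sqr gtr0_norm.
rewrite expr2 -!mulrA ler_pM2l //.
rewrite /cintegral; apply: le_trans (normc_ge_rot _ _ th).
have -> : \int[lebesgue_rn R n]_xi complex.Re (expi (dot x xi + t * enorm xi ^+ 2) * g xi) =
  \int[lebesgue_rn R n]_xi (cos (psi xi) * G xi).
  by apply: eq_Rintegral => xi _; rewrite complex_ReM /= mulr0 subr0.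
have -> : \int[lebesgue_rn R n]_xi complex.Im (expi (dot x xi + t * enorm xi ^+ 2) * g xi) =
  \int[lebesgue_rn R n]_xi (sin (psi xi) * G xi).
  by apply: eq_Rintegral => xi _; rewrite complex_ImM /= mulr0 add0r.
rewrite -!RintegralZr // -RintegralD //; last 2 first.
- rewrite (_ : EFin \o _ = (fun xi => (cos (psi xi) * G xi)%:E * (cos th)%:E)%E) //.
  exact: integrableZr.
- rewrite (_ : EFin \o _ = (fun xi => (sin (psi xi) * G xi)%:E * (sin th)%:E)%E) //.
  exact: integrableZr.
have -> : \int[lebesgue_rn R n]_xi
    (cos (psi xi) * G xi * cos th + sin (psi xi) * G xi * sin th) =
  \int[lebesgue_rn R n]_xi (cos (psi xi - th) * G xi).
  by apply: eq_Rintegral => xi _; rewrite cosB; ring.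
apply: (@le_trans _ _ (\int[lebesgue_rn R n]_xi (2^-1 * G xi))); last first.
  apply: le_Rintegral => //.
    by apply: iG => // y; rewrite ger0_norm //; lra.
  (* The cosine is controlled only where the transform is nonzero; elsewhere both sides vanish. *)
  move=> xi _; have [g0|g0] := eqVneq (G xi) 0; first by rewrite g0 !mulr0.
  rewrite ler_wpM2r //; apply: H; rewrite /wave_hat; apply: contra_neq g0 => g0.
  by have /(congr1 (@complex.Re R)) := g0.
rewrite RintegralZl //; last first.
  apply/integrableP; split; first exact/measurable_EFinP.
  by under eq_integral do rewrite /= ger0_norm //.
rewrite mulrCA ler_pM2l ?invr_gt0 // -lee_fin /Rintegral fineK //.
by rewrite ge0_fin_numE // integral_ge0 // => y _; rewrite lee_fin.
Qed.

(* [f2] need not be measurable: this is applied to the maximal function, a supremum over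
   uncountably many times. *)
Lemma ge0_le_integral_nomeas d (T : measurableType d) (m : {measure set T -> \bar R})
    (f1 f2 : T -> \bar R) : (forall x, 0 <= f1 x)%E -> (forall x, f1 x <= f2 x)%E ->
  (\int[m]_x f1 x <= \int[m]_x f2 x)%E.
Proof.
move=> f10 f12; have f20 x : (0 <= f2 x)%E := le_trans (f10 x) (f12 x).
rewrite !ge0_integralTE //; apply: ge_ereal_sup => _ [h hf1 <-].
by apply: ereal_sup_ubound; exists h => // x; exact: le_trans (hf1 x) (f12 x).
Qed.

(** A Chebyshev-type bound: the maximal function dominates [A] times the indicator of [E]. *)
Lemma maximal_Lp_norm_ge (p rho A : R) (h : Rn R n -> R[i]) (E : set (Rn R n)) :
  0 < p -> 0 <= A -> measurable E -> E `<=` eball (@origin R n) rho ->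
  (forall x, E x -> exists2 t, 0 < t <= rho & A <= normc (schrodinger h t x)) ->
  (A%:E * (lebesgue_rn R n E) `^ p^-1 <= maximal_Lp_norm p h rho)%E.
Proof.
move=> p0 A0 mE Eb H.
rewrite /maximal_Lp_norm unlock /Lnorm.
have AE : (A%:E * (lebesgue_rn R n E) `^ p^-1 = ((A `^ p)%:E * lebesgue_rn R n E) `^ p^-1)%E.
  rewrite poweRM ?lee_fin ?powR_ge0 ?measure_ge0 // poweR_EFin -powRrM mulfV ?gt_eqF //.
  by rewrite powRr1.
rewrite AE; apply: gt0_ler_poweR.
- by rewrite invr_ge0 ltW.
- by rewrite in_itv /= andbC leey mule_ge0 ?lee_fin ?powR_ge0 ?measure_ge0.
- by rewrite in_itv /= andbC leey integral_ge0 // => x _; exact: poweR_ge0.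
have -> : ((A `^ p)%:E * lebesgue_rn R n E =
    \int[lebesgue_rn R n]_x ((A `^ p)%:E * (\1_E x)%:E))%E.
  rewrite ge0_integralZl //.
  - by rewrite integral_indic // setIT.
  - by apply/measurable_EFinP; exact: measurable_indic.
  - by rewrite lee_fin powR_ge0.
apply: ge0_le_integral_nomeas.
  by move=> x; rewrite mule_ge0 // lee_fin powR_ge0.
move=> x; rewrite indicE; case: (boolP (x \in E)) => xE; last by rewrite mule0 poweR_ge0.
rewrite mule1 -poweR_EFin; apply: gt0_ler_poweR; first exact: ltW.
- by rewrite in_itv /= andbC leey lee_fin.
- by rewrite in_itv /= andbC leey abse_ge0.
(* Since [E] lies in the ball, the extension by zero is the maximal function itself on [E]. *)
rewrite patchE mem_set; last by apply: Eb; exact: set_mem.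
have [t /andP[t0 tr] At] := H _ (set_mem xE).
apply: le_trans (lee_abs _); apply: le_trans (ereal_sup_ubound _); last first.
  by exists t; [rewrite /= in_itv /= t0 tr|reflexivity].
by rewrite lee_fin.
Qed.

End lower.

(** * Choosing a time digit by digit *)

Section digits.
Local Open Scope complex_scope.
Context {R : realType}.

(* Adding a multiple of [M^d] to [k] does not affect the conditions [i <= d], and moves
   [k / M^(d+1)] by multiples of [1 / M]. *)
Lemma digits (M d k0 : nat) (y : nat -> R) : (0 < M)%N ->
  exists k, (k0 <= k < k0 + M ^ d)%N /\ forall i, (0 < i <= d)%N ->
    exists z : int, 0 <= y i + k%:R / M%:R ^+ i - z%:~R < M%:R^-1.
Proof.
move=> M0; have M0Z : M%:Z != 0 by case: M M0.
have MR : 0 < M%:R :> R by rewrite ltr0n.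
have Mn0 : M%:R != 0 :> R by rewrite gt_eqF.
elim: d => [|d [k [/andP[k0k kd] H]]].
  exists k0; split; first by rewrite leqnn expn0 addn1 ltnSn.
  by move=> [|i].
(* Adding [j / M] moves [w] into [[0, 1/M[]. Only [j] modulo [M] matters modulo 1, and this residue
   [c] is the new digit. *)
pose w := y d.+1 + k%:R / M%:R ^+ d.+1.
pose j := - Num.floor (w * M%:R).
pose c := `|(j %% M)%Z|%N.
have cE : c%:Z = (j %% M)%Z by rewrite /c gez0_abs // modz_ge0.
have cM : (c < M)%N by rewrite -ltz_nat cE ltz_pmod // ltz_nat.
have jE : (j%:~R : R) = (j %/ M)%Z%:~R * M%:R + c%:R.
  by rewrite {1}(divz_eq j M) rmorphD rmorphM /= -cE.
exists (k + c * M ^ d)%N; split.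
  apply/andP; split; first by rewrite (leq_trans k0k) ?leq_addr.
  have h : (c * M ^ d + M ^ d <= M ^ d.+1)%N by rewrite -mulSnr expnS leq_mul2r cM orbT.
  apply: (@leq_trans (k0 + M ^ d + c * M ^ d)%N); first by rewrite ltn_add2r.
  by rewrite -addnA leq_add2l addnC.
move=> i /andP[i0 id].
have [Ei|ni] := eqVneq i d.+1.
  rewrite Ei; exists (- (j %/ M)%Z).
  have -> : y d.+1 + (k + c * M ^ d)%:R / M%:R ^+ d.+1 - (- (j %/ M)%Z)%:~R =
     (w * M%:R + j%:~R) / M%:R.
    rewrite jE /w natrD natrM natrX rmorphN /= exprS; field.
    by rewrite Mn0 expf_neq0.
  rewrite /j rmorphN /=; have /andP[f1 f2] := floor_itv (w * M%:R).
  apply/andP; split; first by rewrite divr_ge0 ?(ltW MR) // subr_ge0.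
  rewrite ltr_pdivrMr // mulVf // ltrBlDl; move: f2; by rewrite rmorphD.
have id' : (0 < i <= d)%N by rewrite i0 /=; move: id; rewrite leq_eqVlt (negPf ni).
have [z hz] := H i id'.
(* For [i <= d] the new digit adds the integer [c M^(d-i)] to [k / M^i], which [z] absorbs. *)
exists (z + (c * M ^ (d - i))%N%:Z).
have -> : (z + (c * M ^ (d - i))%N%:Z)%:~R = z%:~R + (c * M ^ (d - i))%:R :> R.
  by rewrite intrD -pmulrn.
have -> : y i + (k + c * M ^ d)%:R / M%:R ^+ i - (z%:~R + (c * M ^ (d - i))%:R) =
   y i + k%:R / M%:R ^+ i - z%:~R.
  have -> : (M ^ d = M ^ (d - i) * M ^ i)%N by rewrite -expnD subnK //; case/andP: id'.
  rewrite natrD !natrM !natrX; field.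
  by rewrite expf_neq0.
exact: hz.
Qed.

Lemma cosDz2pi (x : R) (z : int) : cos (x + 2 * pi * z%:~R) = cos x.
Proof.
have N k : forall y : R, cos (y + 2 * pi * k%:R) = cos y.
  elim: k => [|k IH] y; first by rewrite mulr0 addr0.
  have -> : y + 2 * pi * k.+1%:R = (y + 2 * pi * k%:R) + pi *+ 2.
    by rewrite -natr1 -mulr_natl; ring.
  by rewrite cosD2pi IH.
case: z => k; first exact: N.
rewrite NegzE mulrNz mulrN -pmulrn; have := N k.+1 (x - 2 * pi * k.+1%:R).
by rewrite subrK => ->.
Qed.

Lemma pi_lt4 : pi < 4 :> R.
Proof. by have /andP[_] := @pihalf_02 R; rewrite ltr_pdivrMr // -natrM. Qed.

End digits.

(** * Coherence, one coordinate at a time *)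

Section coordinates.
Local Open Scope complex_scope.
Context {R : realType} (n : nat).
Local Notation normc := ComplexField.Normc.normc.
Variables (b : 'I_n -> R) (N : 'I_n -> nat) (nu : 'I_n -> nat -> R).
Hypothesis b_gt0 : forall i, 0 < b i.
Hypothesis n_gt0 : (0 < n)%N.

(** Write [xi_i = nu_l + eta] with [|eta| < b_i]. The phase splits into its value at [nu_l], a
    transport term [eta (x_i + 2 t nu_l)] and a dispersion term [t eta^2]. The three hypotheses
    allot them [1/(2n)], [1/(4n)] and [1/(4n)], so the total error over [n] coordinates is at most
    1, modulo [2 pi]. *)
Lemma schrodinger_ge_coord (x : Rn R n) (t : R) (th : 'I_n -> R) : 0 <= t ->
  (forall i l, (l < N i)%N -> b i * `|tnth x i + 2 * t * nu i l| <= (4 * n%:R)^-1) ->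
  (forall i, t * b i ^+ 2 <= (4 * n%:R)^-1) ->
  (forall i l, (l < N i)%N -> exists z : int,
     `|tnth x i * nu i l + t * nu i l ^+ 2 - th i - 2 * pi * z%:~R| <= (2 * n%:R)^-1) ->
  fourier_cst (R := R) (n := n) ^+ 2 / 2 * \prod_(i < n) (pi * (N i)%:R)
    <= normc (schrodinger (wave_hat b N nu) t x).
Proof.
move=> t0 H1 H2 H3; apply: (schrodinger_ge b_gt0 (th := \sum_(i < n) th i)) => xi gxi.
have nR : 0 < n%:R :> R by rewrite ltr0n.
have C i : exists z : int,
   `|tnth x i * tnth xi i + t * tnth xi i ^+ 2 - th i - 2 * pi * z%:~R| <= n%:R^-1.
  have [l lN hl] := wave_hat_neq0 b_gt0 gxi i.
  have [z hz] := H3 i l lN; exists z.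
  set nul := nu i l in hl hz *; set eta := tnth xi i - nul in hl *.
  have E : tnth xi i = nul + eta by rewrite /eta subrKC.
  have -> : tnth x i * tnth xi i + t * tnth xi i ^+ 2 - th i - 2 * pi * z%:~R =
    (tnth x i * nul + t * nul ^+ 2 - th i - 2 * pi * z%:~R) +
    (eta * (tnth x i + 2 * t * nul) + t * eta ^+ 2) by rewrite E; ring.
  apply: le_trans (ler_normD _ _) _.
  have -> : n%:R^-1 = (2 * n%:R)^-1 + ((4 * n%:R)^-1 + (4 * n%:R)^-1) :> R.
    by field; rewrite gt_eqF.
  apply: lerD hz _; apply: le_trans (ler_normD _ _) _; apply: lerD.
    rewrite normrM; apply: le_trans (H1 i l lN); apply: ler_wpM2r => //; exact: ltW.
  apply: le_trans (H2 i); rewrite normrM ger0_norm //; apply: ler_wpM2l => //.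
  rewrite normrX lerXn2r ?nnegrE // ltW //; exact: lt_le_trans hl _.
have [z hz] := choice C.
have -> : cos (dot x xi + t * enorm xi ^+ 2 - \sum_(i < n) th i) =
  cos (\sum_(i < n) (tnth x i * tnth xi i + t * tnth xi i ^+ 2 - th i - 2 * pi * (z i)%:~R)).
  rewrite -[LHS](@cosDz2pi _ _ (- \sum_(i < n) z i)); congr cos.
  rewrite enorm_sqr /dot rmorphN rmorph_sum /= !big_distrr /= -sumrN.
  rewrite mulrN big_distrr /= -!sumrN -!big_split /=.
  by apply: eq_bigr => i _; rewrite expr2.
apply: cos_ge_half; apply: le_trans (ler_norm_sum _ _ _) _.
apply: (@le_trans _ _ (\sum_(i < n) n%:R^-1)); first by apply: ler_sum => i _; exact: hz.
by rewrite sumr_const card_ord -[_ *+ n]mulr_natr mulVf // gt_eqF.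
Qed.

End coordinates.

(** * The example *)

Section example.
Local Open Scope complex_scope.
Context {R : realType} (n m K : nat).
Local Notation normc := ComplexField.Normc.normc.
Hypotheses (n_gt2 : (2 < n)%N) (K_gt0 : (0 < K)%N).

(* Coordinates are numbered from [0]: the travelling packet is [i = 0], the frequency
   combs are [0 < i < m], the resting packets are [m <= i].  [width] is the square root of
   [radius], [band] is the half-width of one frequency bump, and [copies] is the number of
   bumps. *)
Definition base : nat := (16 * n * K)%N.
Local Notation M := base.
Definition width : R := 8 * M%:R ^+ m.+1.
Definition radius : R := width ^+ 2.
Definition scale (i : 'I_n) : R := if (0 < i < m)%N then radius else width.
Definition band (i : 'I_n) : R := (8 * n%:R * scale i)^-1.
Definition copies (i : 'I_n) : nat := if (0 < i < m)%N then K else 1%N.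
(** At [t = 2 pi k M^2] the offset [1 / (2 M^(i+1))] and the step [l / M] have cross term
    [2 pi k l / M^i] in [t nu^2], which is the origin of the conditions on [k / M^i], while
    [t (l / M)^2 = 2 pi k l^2]. The frequency [1/(4n)] gives the speed [1/(2n)]. *)
Definition freq (i : 'I_n) (l : nat) : R :=
  if (i == 0 :> nat)%N then (4 * n%:R)^-1
  else if (i < m)%N then (2 * M%:R ^+ i.+1)^-1 + l%:R / M%:R else 0.
(** At speed [1/(2n)] the travelling packet crosses the length [radius / (4n)] in time [radius / 2].
    The box extends to negative coordinates because the phase [x xi + t xi^2] places a packet of
    frequency [nu] near [x = - 2 t nu]. *)
Definition side (i : 'I_n) : R := (if (i < m)%N then radius else width) / (4 * n%:R).
Definition box : set (Rn R n) := [set x | forall i, `[- side i, 0]%classic (tnth x i)].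

Lemma n_ge3 : 3 <= n%:R :> R. Proof. by rewrite ler_nat. Qed.
Let n0 : 0 < n%:R :> R. Proof. by apply: lt_le_trans n_ge3. Qed.
Lemma base_gt0 : (0 < M)%N. Proof. by rewrite /base !muln_gt0 K_gt0 (ltn_trans _ n_gt2). Qed.
Lemma baseE : M%:R = 16 * n%:R * K%:R :> R. Proof. by rewrite /base !natrM. Qed.
Let K1 : 1 <= K%:R :> R. Proof. by rewrite ler1n. Qed.
Let M16 : 16 * n%:R <= M%:R :> R.
Proof. by rewrite baseE ler_peMr // mulr_ge0. Qed.
Let M1 : 1 <= M%:R :> R. Proof. by rewrite ler1n base_gt0. Qed.
Let M0 : 0 < M%:R :> R. Proof. by rewrite ltr0n base_gt0. Qed.
Lemma base_le_width : 8 * M%:R <= width.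
Proof. by rewrite /width ler_pM2l // exprS ler_peMr ?(ltW M0) // exprn_ege1. Qed.
Lemma width_ge8 : 8 <= width. Proof. have := base_le_width; have := M1; lra. Qed.
Let W0 : 0 < width. Proof. have := width_ge8; lra. Qed.
Lemma width_le_radius : 8 * width <= radius.
Proof. by rewrite /radius expr2 ler_wpM2r ?width_ge8 // ltW. Qed.
Lemma radius_gt1 : 1 < radius. Proof. have := width_le_radius; have := width_ge8; lra. Qed.
Let r0 : 0 < radius. Proof. have := radius_gt1; lra. Qed.
Lemma scale_ge_width i : width <= scale i.
Proof. rewrite /scale; case: ifP => // _; have := width_le_radius; have := width_ge8; lra. Qed.
Let s0 i : 0 < scale i. Proof. exact: lt_le_trans (scale_ge_width i). Qed.

Lemma band_gt0 i : 0 < band i.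
Proof. by rewrite /band invr_gt0 !mulr_gt0. Qed.

Lemma freq_sep i l k : (l < copies i)%N -> (k < copies i)%N -> l != k ->
  band i <= `|freq i l - freq i k|.
Proof.
rewrite /copies; case: ifP => [/andP[i0 im] _ _ lk|_]; last first.
  by case: l k => [|l] [|k].
rewrite /freq eqn0Ngt i0 /= im.
have -> : (2 * M%:R ^+ i.+1)^-1 + l%:R / M%:R - ((2 * M%:R ^+ i.+1)^-1 + k%:R / M%:R) =
  (l%:R - k%:R) / M%:R :> R by ring.
rewrite normrM normfV (gtr0_norm M0).
have lk1 : 1 <= `|l%:R - k%:R| :> R.
  wlog lk' : l k lk / (k < l)%N.
    move=> H; move: (lk); rewrite neq_ltn => /orP[?|?]; [rewrite distrC|];
      by apply: H => //; rewrite eq_sym.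
  by rewrite -natrB ?(ltnW lk') // normr_nat ler1n subn_gt0.
apply: (@le_trans _ _ (M%:R^-1)); last by rewrite ler_peMl // invr_ge0 ltW.
rewrite /band lef_pV2 ?posrE ?mulr_gt0 //.
have h1 := scale_ge_width i; have h2 := base_le_width; have h3 := M0.
have : 1 * scale i <= 8 * n%:R * scale i.
  by rewrite ler_wpM2r ?(ltW (s0 i)) //; have := n_ge3; lra.
lra.
Qed.

(** The travelling frequency is [1/(4n)], a comb frequency at most [1/M + K/M <= 1/(8n)], and a band
    at most [1/(8n)]. *)
Lemma freq_bound i l : (l < copies i)%N -> `|freq i l| + band i <= (2 * n%:R)^-1.
Proof.
move=> lc.
have hb : band i <= (8 * n%:R)^-1.
  rewrite /band lef_pV2 ?posrE ?mulr_gt0 // ler_peMr ?mulr_ge0 //.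
  have := scale_ge_width i; have := width_ge8; lra.
have nE c : (c * n%:R)^-1 = c^-1 * n%:R^-1 :> R by rewrite invfM.
have ni : 0 < n%:R^-1 :> R by rewrite invr_gt0.
rewrite nE in hb; rewrite nE.
suff : `|freq i l| <= 4^-1 * n%:R^-1 by lra.
rewrite /freq; case: ifP => [_|i0]; first by rewrite nE ger0_norm // mulr_ge0 // invr_ge0.
case: ifP => im; last by rewrite normr0 mulr_ge0 // invr_ge0.
have lK : (l < K)%N by move: lc; rewrite /copies lt0n i0 im.
have Mi : 0 < M%:R^-1 :> R by rewrite invr_gt0.
rewrite ger0_norm; last by rewrite addr_ge0 ?mulr_ge0 ?invr_ge0 ?mulr_ge0 ?exprn_ge0 // ltW.
have h1 : (2 * M%:R ^+ i.+1)^-1 <= M%:R^-1 :> R.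
  rewrite lef_pV2 ?posrE ?mulr_gt0 ?exprn_gt0 // exprS mulrCA ler_peMr ?(ltW M0) //.
  have : 1 <= M%:R ^+ i :> R by exact: exprn_ege1.
  lra.
have h2 : M%:R^-1 <= 16^-1 * n%:R^-1 :> R by rewrite -nE lef_pV2 ?posrE ?mulr_gt0.
have h3 : l%:R / M%:R <= 16^-1 * n%:R^-1 :> R.
  rewrite ler_pdivrMr // baseE.
  have -> : 16^-1 * n%:R^-1 * (16 * n%:R * K%:R) = K%:R :> R by field; rewrite gt_eqF.
  by rewrite ler_nat ltnW.
lra.
Qed.

Lemma measurable_example_box : measurable box.
Proof.
exact: (measurable_box (A := fun i => `[- side i, 0]%classic) (fun i => measurable_itv _)).
Qed.

Let side_ge0 i : 0 <= side i.
Proof. by rewrite /side divr_ge0 ?mulr_ge0 //; case: ifP => _; rewrite ltW. Qed.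

Lemma measure_example_box : lebesgue_rn R n box = (\prod_(i < n) side i)%:E.
Proof.
rewrite (lebesgue_rn_box (A := fun i => `[- side i, 0]%classic) (fun i => measurable_itv _)).
rewrite -prodEFin; apply: eq_bigr => i _.
rewrite lebesgue_measure_itv /= lte_fin oppr_lt0.
have := side_ge0 i; rewrite le_eqVlt => /orP[/eqP <-|->]; first by rewrite ltxx.
by rewrite -EFinB sub0r opprK.
Qed.

Lemma side_le i : side i <= radius / (4 * n%:R).
Proof.
rewrite /side ler_wpM2r ?invr_ge0 ?mulr_ge0 //; case: ifP => // _.
have := width_le_radius; have := width_ge8; lra.
Qed.

Lemma box_coord x i : box x -> `|tnth x i : R| <= side i.
Proof.
by move=> /(_ i); rewrite /= in_itv /= => /andP[h1 h2]; rewrite ler0_norm // lerNl.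
Qed.

Lemma box_sub_ball : box `<=` eball (@origin R n) radius.
Proof.
move=> x xE; rewrite /eball /=; apply: enorm_lt => //; first exact: ltn_trans n_gt2.
move=> i; rewrite tnth_mktuple tnth_mktuple subr0.
apply: le_trans (box_coord i xE) _; apply: le_trans (side_le i) _.
rewrite ler_pM2l // lef_pV2 ?posrE ?mulr_gt0 //; have := n0; lra.
Qed.

End example.

(** * Focusing at every point of the box *)

Section focusing.
Local Open Scope complex_scope.
Context {R : realType} (n m K : nat).
Local Notation normc := ComplexField.Normc.normc.
Hypotheses (n_gt2 : (2 < n)%N) (m_gt0 : (0 < m)%N) (K_gt0 : (0 < K)%N).
Local Notation M := (base n K).
Local Notation W := (@width R n m K).
Local Notation rho := (@radius R n m K).
Local Notation sc := (@scale R n m K).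
Local Notation bw := (@band R n m K).
Local Notation fr := (@freq R n m K).

(** The travelling packet stays near [x_0] for a time [W] after its arrival [T0]. This window
    contains [M^(m-1)] consecutive admissible times, enough for [digits] to meet the [m - 1] comb
    conditions. *)
Lemma focusing_time (x : Rn R n) : box m K x ->
  exists k : nat, let t := 2 * pi * M%:R ^+ 2 * k%:R : R in
  [/\ 0 < t <= rho,
      forall i : 'I_n, i = 0%N :> nat -> `|tnth x i + t / (2 * n%:R)| <= W / (2 * n%:R) &
      forall i : 'I_n, (0 < i < m)%N -> exists z : int,
        0 <= tnth x i / (2 * pi * M%:R) + k%:R / M%:R ^+ i - z%:~R < M%:R^-1].
Proof.
move=> xE.
have n3 := @n_ge3 R n n_gt2; have n0 : 0 < n%:R :> R by lra.
have M0 : 0 < M%:R :> R by rewrite ltr0n (base_gt0 n_gt2 K_gt0).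
have p0 := @pi_gt0 R; have p4 := @pi_lt4 R.
have W8 := @width_ge8 R n m K n_gt2 K_gt0.
have Wr := @width_le_radius R n m K n_gt2 K_gt0.
pose i0 := Ordinal (ltn_trans (ltn0Sn 1) n_gt2).
(* The arrival time solves [x_0 + T0 / (2n) = 0]. *)
pose T0 := - (2 * n%:R * tnth x i0) : R.
have /andP[T0_ge0 T0_le] : 0 <= T0 <= rho / 2.
  have := xE i0; rewrite /= in_itv /= /side m_gt0 => /andP[h1 h2].
  apply/andP; split; first by rewrite /T0 oppr_ge0 mulr_ge0_le0 // mulr_ge0 // ltW.
  have -> : rho / 2 = 2 * n%:R * (rho / (4 * n%:R)) by field; rewrite gt_eqF.
  by rewrite /T0 -mulrN ler_pM2l ?mulr_gt0 // lerNl.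
pose q := 2 * pi * M%:R ^+ 2 : R.
have q0 : 0 < q by rewrite !mulr_gt0 // exprn_gt0.
(* The sequence given to [digits] is indexed by all naturals; it is 0 from [n] on. *)
pose y i := (if insub i is Some j then tnth x (j : 'I_n) else 0) / (2 * pi * M%:R) : R.
(* Starting one above the truncation of [T0 / q] gives [t > T0 >= 0], hence a strictly positive
   time. *)
have [k [/andP[k1 k2] H]] := digits m.-1 (Num.trunc (T0 / q)).+1 y (base_gt0 n_gt2 K_gt0).
exists k => t.
have tE : t = q * k%:R by [].
have /andP[tr1 tr2] := truncn_itv (divr_ge0 T0_ge0 (ltW q0)).
have tT : T0 < t.
  rewrite tE -ltr_pdivrMl // mulrC; apply: lt_le_trans tr2 _.
  by rewrite ler_nat.
(* The window lasts [2 pi M^(m+1)], and the 8 in [width] exceeds [2 pi] since [pi < 4]. *)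
have qW : q * M%:R ^+ m.-1 <= W.
  have -> : q * M%:R ^+ m.-1 = 2 * pi * M%:R ^+ m.+1.
    by rewrite /q -mulrA -exprD; congr (_ * _ ^+ _); rewrite -[in RHS](prednK m_gt0).
  rewrite /width ler_wpM2r ?exprn_ge0 ?(ltW M0) //; lra.
have tW : t <= T0 + W.
  have k3 : (k%:R <= (Num.trunc (T0 / q))%:R + M%:R ^+ m.-1 :> R).
    by rewrite -natrX -natrD ler_nat -ltnS -addSn.
  apply: (@le_trans _ _ (q * ((Num.trunc (T0 / q))%:R + M%:R ^+ m.-1))).
    by rewrite tE ler_pM2l.
  rewrite mulrDr lerD // mulrC -ler_pdivlMr //.
have t0 : 0 < t by exact: le_lt_trans tT.
split.
(* Here [t <= T0 + W <= rho / 2 + rho / 8]. *)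
- by rewrite t0 /=; lra.
- move=> i Ei; have -> : i = i0 by apply/val_inj.
  have -> : tnth x i0 + t / (2 * n%:R) = (t - T0) / (2 * n%:R).
    by rewrite /T0; field; rewrite gt_eqF.
  rewrite normrM (ger0_norm (_ : 0 <= (2 * n%:R)^-1)) ?invr_ge0 ?mulr_ge0 ?(ltW n0) //.
  rewrite ler_pM2r ?invr_gt0 ?mulr_gt0 // ger0_norm; lra.
- move=> i /andP[i1 im].
  have im' : (0 < i <= m.-1)%N by rewrite i1 /= -ltnS prednK.
  have [z hz] := H i im'; exists z; move: hz; rewrite /y.
  by have -> : insub (i : nat) = Some i by exact: valK.
Qed.

(** The transport, dispersion and phase conditions of [schrodinger_ge_coord] are checked at the time
    given by [focusing_time], for comb, travelling and resting coordinates. *)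
Lemma schrodinger_box_ge (x : Rn R n) : box m K x ->
  exists2 t, 0 < t <= rho &
    fourier_cst (R := R) (n := n) ^+ 2 / 2 * \prod_(i < n) (pi * (copies m K i)%:R)
      <= normc (schrodinger (wave_hat bw (copies m K) fr) t x).
Proof.
move=> xE; have [k /=] := focusing_time xE.
set t := (X in 0 < X <= _) => -[/andP[t0 tr] H0 Hmid].
exists t; first by rewrite t0.
have n3 := @n_ge3 R n n_gt2; have n0 : 0 < n%:R :> R by lra.
have ni0 : 0 < n%:R^-1 :> R by rewrite invr_gt0.
have M0 : 0 < M%:R :> R by rewrite ltr0n (base_gt0 n_gt2 K_gt0).
have K0 : 0 < K%:R :> R by rewrite ltr0n.
have p0 := @pi_gt0 R; have p4 := @pi_lt4 R.
have W8 := @width_ge8 R n m K n_gt2 K_gt0.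
have Wr := @width_le_radius R n m K n_gt2 K_gt0.
have s0 (i : 'I_n) : 0 < sc i by have := @scale_ge_width R n m K n_gt2 K_gt0 i; lra.
have bE (i : 'I_n) : bw i = 8^-1 * n%:R^-1 * (sc i)^-1 by rewrite /band !invfM.
have cE c : (c * n%:R)^-1 = c^-1 * n%:R^-1 :> R by rewrite invfM.
pose mid (i : 'I_n) := (0 < i < m)%N.
(* The reference phase is that of [l = 0]: nothing remains to check for a single packet, and only
   terms containing [l] survive in a comb. *)
apply: (@schrodinger_ge_coord R n bw (@copies n m K) fr (@band_gt0 R n m K n_gt2 K_gt0)
  (ltn_trans (ltn0Sn 1) n_gt2) x t (fun i => tnth x i * fr i 0 + t * fr i 0 ^+ 2)).
- exact: ltW.
- move=> i l lc.
  (* With [band = 1 / (8 n scale)], a distance of [2 scale] from the packet centre costs exactly the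
     allowed [1/(4n)]. *)
  suff h : `|tnth x i + 2 * t * fr i l| <= 2 * sc i.
    rewrite bE cE; apply: (@le_trans _ _ (8^-1 * n%:R^-1 / sc i * (2 * sc i))).
      by rewrite ler_wpM2l // !mulr_ge0 // invr_ge0 ltW.
    by have -> : 8^-1 * n%:R^-1 / sc i * (2 * sc i) = 4^-1 * n%:R^-1 :> R
      by field; rewrite !gt_eqF.
  (* Comb packets are so wide that transport is harmless: [|x_i| <= rho] and [2 t |nu| <= rho], as
     [|nu| <= 1/2]. *)
  have [imid|] := boolP (mid i).
    rewrite /scale (_ : (0 < i < m)%N = true) //; apply: le_trans (ler_normD _ _) _.
    have fb := @freq_bound R n m K n_gt2 K_gt0 i l lc.
    have b0 := @band_gt0 R n m K n_gt2 K_gt0 i.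
    have xs := le_trans (box_coord i xE) (@side_le R n m K n_gt2 K_gt0 i).
    have ni1 : n%:R^-1 <= 3^-1 :> R by rewrite lef_pV2 ?posrE.
    rewrite cE in fb; rewrite cE in xs.
    have -> : 2 * rho = rho + rho by ring.
    apply: lerD.
      apply: le_trans xs _; rewrite ler_piMr //; lra.
    rewrite normrM (gtr0_norm (_ : 0 < 2 * t)); last lra.
    apply: (@le_trans _ _ (2 * t * 2^-1)); last lra.
    rewrite ler_pM2l; lra.
  rewrite negb_and -leqNgt leqn0 -leqNgt => /orP[/eqP i0|mi].
    have f0 : fr i l = (4 * n%:R)^-1 by rewrite /freq i0.
    rewrite f0 /scale i0 ltnn /=.
    have -> : tnth x i + 2 * t * (4 * n%:R)^-1 = tnth x i + t / (2 * n%:R).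
      by field; rewrite gt_eqF.
    apply: le_trans (H0 i i0) _; rewrite ler_pdivrMr ?mulr_gt0 //.
    have : 2 * W * 1 <= 2 * W * (2 * n%:R) by rewrite ler_wpM2l //; lra.
    lra.
  have i1 : (0 < i)%N by exact: leq_trans mi.
  have f0 : fr i l = 0 by rewrite /freq eqn0Ngt i1 /= ltnNge mi.
  rewrite f0 mulr0 addr0 /scale i1 ltnNge mi /=.
  apply: le_trans (box_coord i xE) _; rewrite /side ltnNge mi /= cE.
  have ni1 : n%:R^-1 <= 3^-1 :> R by rewrite lef_pV2 ?posrE.
  by rewrite [leLHS]mulrC; apply: ler_wpM2r; lra.
- move=> i; rewrite bE cE.
  (* Dispersion is controlled because [t <= rho = W^2 <= scale^2]. *)
  have -> : t * (8^-1 * n%:R^-1 / sc i) ^+ 2 =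
     4^-1 * n%:R^-1 * (16^-1 * n%:R^-1 * (t / sc i ^+ 2)) :> R by field; rewrite !gt_eqF.
  rewrite ler_piMr ?mulr_ge0 ?invr_ge0 ?(ltW n0) //.
  have h1 : t / sc i ^+ 2 <= 1.
    rewrite ler_pdivrMr ?exprn_gt0 // mul1r; apply: le_trans tr _.
    rewrite /radius lerXn2r ?nnegrE ?(ltW (s0 _)) //; first lra.
    exact: (@scale_ge_width R n m K).
  have h0 : 0 <= t / sc i ^+ 2 by rewrite divr_ge0 ?exprn_ge0 // ltW.
  have ni1 : n%:R^-1 <= 3^-1 :> R by rewrite lef_pV2 ?posrE.
  by apply: mulr_ile1; [rewrite mulr_ge0 ?invr_ge0 // ltW|exact: h0|lra|exact: h1].
- move=> i l lc.
  have [/andP[i1 im]|imid] := boolP (mid i); last first.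
    exists 0; rewrite mulr0 subr0.
    have -> : l = 0%N by move: lc; rewrite /copies -/(mid i) (negPf imid); case: l.
    by rewrite subrr normr0 cE mulr_ge0 ?invr_ge0 // ltW.
  have [z /andP[hz0 hz1]] := Hmid i (introT andP (conj i1 im)).
  (* These are the whole turns: [l z] from the comb condition, and [k l^2] from
     [t (l / M)^2 = 2 pi k l^2]. The remaining phase is [2 pi l s]. *)
  exists (l%:Z * z + (k * l ^ 2)%N%:Z).
  set s := (X in 0 <= X) in hz0; rewrite -/s in hz1.
  have lK : (l <= K)%N by move: lc; rewrite /copies i1 im; exact: ltnW.
  rewrite intrD intrM -!pmulrn natrM natrX.
  have f0 j : fr i j = (2 * M%:R ^+ i.+1)^-1 + j%:R / M%:R :> R.
    by rewrite /freq eqn0Ngt i1 /= im.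
  rewrite !f0.
  have -> : z%:~R = tnth x i / (2 * pi * M%:R) + k%:R / M%:R ^+ i - s.
    by rewrite /s opprB addrC subrK.
  set X := (X in `|X|).
  have -> : X = 2 * pi * (l%:R * s).
    rewrite /X /t exprS; move: (pi : R) (lt0r_neq0 p0) => P Pn0; field.
    by rewrite Pn0 expf_neq0 gt_eqF.
  rewrite ger0_norm ?mulr_ge0 // ?(ltW p0) //.
  (* With [pi < 4], [l <= K] and [s < 1/M], the choice [M = 16 n K] makes [8 K / M] exactly
     [1/(2n)]. *)
  apply: (@le_trans _ _ (2 * 4 * (K%:R * M%:R^-1))).
    apply: ler_pM; rewrite ?mulr_ge0 //; [exact: ltW|lra|].
    by apply: ler_pM => //; [rewrite ler_nat|exact: ltW].
  rewrite baseE le_eqVlt; apply/orP; left; apply/eqP; field.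
  by rewrite !gt_eqF.
Qed.

End focusing.

(** * Asymptotics *)

Section asymptotics.
Context {R : realType}.

(** If [b < a], then [K^(a-b) <= C] for every [K], which fails as soon as [K] exceeds
    [C^(1/(a-b))]. *)
Lemma powR_growth (C a b : R) :
  (forall K : nat, (0 < K)%N -> K%:R `^ a <= C * K%:R `^ b) -> a <= b.
Proof.
move=> H; rewrite leNgt; apply/negP => ba; pose d := a - b.
have d0 : 0 < d by rewrite subr_gt0.
(* The case [K = 1] reads [1 <= C]. *)
have C0 : 0 < C by have := H 1%N isT; rewrite !powR1 mulr1; apply: lt_le_trans.
pose K := (Num.trunc (C `^ d^-1)).+1.
have K0 : 0 < K%:R :> R by rewrite ltr0n.
have := H K isT; rewrite leNgt => /negP; apply.
rewrite -ltr_pdivlMr ?powR_gt0 // -powRB ?gt_eqF // -/d.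
have -> : C = (C `^ d^-1) `^ d by rewrite -powRrM mulVf ?lt0r_neq0 // powRr1 ?(ltW C0).
by apply: gt0_ltr_powR; rewrite ?nnegrE ?powR_ge0 ?(ltW K0) //; exact: truncnS_gt.
Qed.

Lemma prod_monomial n (F : 'I_n -> R) (c : 'I_n -> R) (e : 'I_n -> nat) (x : R) :
  (forall i, F i = c i * x ^+ e i) ->
  \prod_(i < n) F i = (\prod_(i < n) c i) * x ^+ (\sum_(i < n) e i).
Proof.
move=> h; rewrite (eq_bigr _ (fun i _ => h i)) big_split /=; congr (_ * _).
by rewrite expr_sum.
Qed.

Lemma sum_ord_lt n m (a b : nat) : (m <= n)%N ->
  (\sum_(i < n) (if (i < m)%N then a else b) = m * a + (n - m) * b)%N.
Proof.
move=> mn; rewrite -(big_mkord xpredT (fun i => if (i < m)%N then a else b)).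
rewrite (big_cat_nat (n := m)) //=; congr (_ + _)%N.
  rewrite (eq_big_nat _ _ (F2 := fun=> a)); last by move=> i /andP[_ ->].
  by rewrite sum_nat_const_nat subn0.
rewrite (eq_big_nat _ _ (F2 := fun=> b)); last by move=> i /andP[mi _]; rewrite ltnNge mi.
by rewrite sum_nat_const_nat.
Qed.

Lemma sum_ord_mid n m (a b : nat) : (0 < m <= n)%N ->
  (\sum_(i < n) (if (0 < i < m)%N then a else b) = m.-1 * a + (n - m.-1) * b)%N.
Proof.
case/andP => m0 mn.
case: n mn => [|n] mn; first by rewrite leqNgt m0 in mn.
rewrite big_ord_recl /=.
under eq_bigr => i _ do rewrite /bump /= add1n /= -ltn_predRL.
rewrite sum_ord_lt; last by rewrite -ltnS prednK.
rewrite addnCA; congr (_ + _)%N; rewrite subSn ?mulSn //.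
by rewrite -ltnS prednK.
Qed.

Variables (n m : nat).
Hypotheses (n_gt2 : (2 < n)%N) (m_gt0 : (0 < m)%N) (m_len : (m <= n)%N).

(** Because [M] is a fixed multiple of [K], this and the quantities below are exact monomials in [K]
    with coefficients independent of [K]; only their exponents matter in the end. *)
Lemma width_monomial : exists2 c : R, 0 < c &
  forall K, (0 < K)%N -> width n m K = c * K%:R ^+ m.+1.
Proof.
exists (8 * (16 * n%:R) ^+ m.+1).
  by rewrite mulr_gt0 ?exprn_gt0 ?mulr_gt0 // ltr0n (ltn_trans _ n_gt2).
by move=> K _; rewrite /width baseE exprMn mulrA.
Qed.

Lemma radius_monomial : exists2 c : R, 0 < c &
  forall K, (0 < K)%N -> radius n m K = c * K%:R ^+ (2 * m.+1).
Proof.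
have [c c0 h] := width_monomial; exists (c ^+ 2); first exact: exprn_gt0.
by move=> K K0; rewrite /radius h // exprMn -exprM mulnC.
Qed.

Let n0 : 0 < n%:R :> R. Proof. by rewrite ltr0n (ltn_trans _ n_gt2). Qed.

(** The [m] long sides have degree [2(m+1)] and the [n - m] short ones degree [m+1], in total
    [(m+1)(n+m)]. *)
Lemma side_monomial : exists2 c : R, 0 < c &
  forall K, (0 < K)%N -> \prod_(i < n) side m K i = c * K%:R ^+ (m.+1 * (n + m)).
Proof.
have [cr cr0 rE] := radius_monomial; have [cw cw0 wE] := width_monomial.
exists (\prod_(i < n) ((if (i < m)%N then cr else cw) / (4 * n%:R))).
  by apply: prodr_gt0 => i _; rewrite divr_gt0 ?mulr_gt0 //; case: ifP.
move=> K K0.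
rewrite (prod_monomial (c := fun i => (if (i < m)%N then cr else cw) / (4 * n%:R))
  (e := fun i => if (i < m)%N then (2 * m.+1)%N else m.+1) (x := K%:R)); last first.
  by move=> i; rewrite /side rE // wE //; case: ifP => _; rewrite mulrAC.
congr (_ * _ ^+ _); rewrite sum_ord_lt // mulnA -mulnDl mulnC; congr (_ * _)%N.
by rewrite muln2 -addnn -addnA subnKC // addnC.
Qed.

Lemma copies_monomial : forall K, (0 < K)%N ->
  \prod_(i < n) (pi * (copies m K i)%:R) = pi ^+ n * K%:R ^+ m.-1 :> R.
Proof.
move=> K K0; rewrite (prod_monomial (c := fun=> pi)
  (e := fun i => if (0 < i < m)%N then 1%N else 0%N) (x := K%:R)).
  by rewrite prodr_const card_ord sum_ord_mid ?m_gt0 // muln1 muln0 addn0.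
by move=> i; rewrite /copies; case: ifP.
Qed.

(* The product is the bound of [cLnorm2_wave] for the squared L^2 norm of the data. *)
Lemma mass_monomial : exists2 c : R, 0 < c &
  forall K, (0 < K)%N -> \prod_(i < n) (2 * pi / band m K i * (copies m K i)%:R) =
    c * K%:R ^+ (m.-1 + m.+1 * (n + m).-1).
Proof.
have [cr cr0 rE] := radius_monomial; have [cw cw0 wE] := width_monomial.
exists (\prod_(i < n) (2 * pi * (8 * n%:R * (if (0 < i < m)%N then cr else cw)))).
  by apply: prodr_gt0 => i _; rewrite !mulr_gt0 ?pi_gt0 //; case: ifP.
move=> K K0; rewrite (prod_monomial
  (c := fun i => 2 * pi * (8 * n%:R * (if (0 < i < m)%N then cr else cw)))
  (e := fun i => if (0 < i < m)%N then (2 * m.+1 + 1)%N else m.+1) (x := K%:R)); last first.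
  move=> i; rewrite /band /scale /copies invrK rE // wE //.
  by case: ifP => _; rewrite ?exprD; ring.
(* The [m - 1] combs have degree [2(m+1) + 1] and the other [n - m + 1] coordinates degree [m+1]. *)
congr (_ * _ ^+ _); rewrite sum_ord_mid ?m_gt0 //.
case: m m_gt0 m_len => // m' _ m'n /=.
rewrite mulnDr muln1 [in RHS]addnC addnAC; congr (_ + _)%N.
rewrite mulnA -mulnDl mulnC; congr (_ * _)%N.
by rewrite addnS /= muln2 -addnn -addnA subnKC 1?addnC // ltnW.
Qed.

End asymptotics.

(** * Comparison of the exponents of [K] *)

Section exponent.
Context {R : realType}.

Lemma monomial_powR (c : R) (e : nat) (K : nat) (a : R) : 0 < c -> (0 < K)%N ->
  (c * K%:R ^+ e) `^ a = c `^ a * K%:R `^ (e%:R * a).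
Proof.
move=> c0 K0; rewrite powRM ?(ltW c0) ?exprn_ge0 //; congr (_ * _).
by rewrite -powR_mulrn // -powRrM.
Qed.

(** Letting [K] grow gives [(m-1) + (m+1)(n+m)/p <= 2(m+1)(eps + gamma) + ((m-1) + (m+1)(n+m-1))/2]:
    on the left the amplitude and the box, on the right the power of the radius and the [L^2] norm.
    Division by [2(m+1)] yields the claim up to [eps]. *)
Lemma maximal_exponent_ge (n m : nat) (p gamma : R) : (2 < n)%N -> (0 < m <= n)%N ->
  0 < p -> maximal_exponent n p gamma ->
  (n + m)%:R / 2 * (p^-1 - 2^-1) + m%:R / (2 * (m.+1)%:R) <= gamma.
Proof.
move=> n2 /andP[m0 mn] p0 H; apply/ler_addgt0Pr => eps eps0.
have [C [C0 HC]] := H eps eps0.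
have [cr cr0 rE] := radius_monomial m n2 (R := R).
have [cs cs0 sE] := side_monomial n2 mn (R := R).
have [cm cm0 mE] := mass_monomial n2 m0 mn (R := R).
pose A : R := fourier_cst (R := R) (n := n) ^+ 2 / 2 * pi ^+ n.
have A0 : 0 < A by rewrite mulr_gt0 ?divr_gt0 ?exprn_gt0 ?fourier_cst_gt0 ?pi_gt0.
(* All the factors independent of [K] are collected in [D]. *)
pose D := C * cr `^ eps * cr `^ gamma * cm `^ 2^-1 / (A * cs `^ p^-1).
have key K : (0 < K)%N ->
  K%:R `^ (m.-1%:R + (m.+1 * (n + m))%:R * p^-1) <=
  D * K%:R `^ ((2 * m.+1)%:R * eps + (2 * m.+1)%:R * gamma +
    (m.-1 + m.+1 * (n + m).-1)%:R * 2^-1).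
  move=> K0; have KR : 0 < K%:R :> R by rewrite ltr0n.
  have KD a b : K%:R `^ (a + b) = K%:R `^ a * K%:R `^ b :> R.
    by rewrite powRD //; apply/implyP => _; rewrite gt_eqF.
  pose f := wave (@band R n m K) (copies m K) (freq m K).
  pose g := wave_hat (@band R n m K) (copies m K) (freq m K).
  have b0 := @band_gt0 R n m K n2 K0.
  have sep := @freq_sep R n m K n2 K0.
  have := HC (radius n m K) f g (radius_gt1 m n2 K0) (inLp2_wave b0 sep)
    (is_fourier_wave b0 sep) (ess_support_wave_hat b0 (ltnW n2) (@freq_bound R n m K n2 K0)).
  have lower := maximal_Lp_norm_ge p0 _ (@measurable_example_box R n m K)
     (@box_sub_ball R n m K n2 K0) (fun x => schrodinger_box_ge n2 m0 K0 (x := x)).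
  rewrite copies_monomial // in lower.
  have {}lower := lower _.
  have AE : fourier_cst (R := R) (n := n) ^+ 2 / 2 * (pi ^+ n * K%:R ^+ m.-1) =
      A * K%:R ^+ m.-1.
    by rewrite /A mulrA.
  rewrite AE in lower.
  have AK0 : 0 <= A * K%:R ^+ m.-1 by rewrite mulr_ge0 ?exprn_ge0 // ltW.
  move=> /(le_trans (lower AK0)).
  rewrite measure_example_box // poweR_EFin -EFinM => upper.
  have Z0 : 0 <= C * radius n m K `^ eps * radius n m K `^ gamma.
    by rewrite !mulr_ge0 ?powR_ge0 // ltW.
  have := le_trans upper (lee_wpmul2l _ (cLnorm2_wave b0 sep)); rewrite lee_fin => /(_ Z0).
  rewrite -EFinM lee_fin sE // mE // rE // !monomial_powR // -(@powR_mulrn _ K%:R) //.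
  set k1 := K%:R `^ _; set k2 := K%:R `^ _; set k3 := K%:R `^ _.
  set k4 := K%:R `^ _; set k5 := K%:R `^ _.
  rewrite !KD -/k1 -/k2 -/k3 -/k4 -/k5 => h.
  have d0 : 0 < A * cs `^ p^-1 by rewrite mulr_gt0 ?powR_gt0.
  rewrite -(ler_pM2l d0).
  have -> : A * cs `^ p^-1 * (k1 * k2) = A * k1 * (cs `^ p^-1 * k2) by ring.
  apply: le_trans h _; rewrite le_eqVlt; apply/orP; left; apply/eqP; rewrite /D.
  by field; rewrite !gt_eqF ?powR_gt0.
have := powR_growth key.
(* Writing [m = m' + 1] removes the truncated predecessors, so that the exponents become polynomials
   over the reals. *)
case: m m0 mn {rE sE mE key D cr cr0 cs cs0 cm cm0} => // m' _ mn /=.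
have nm1 : ((n + m'.+1).-1%:R = n%:R + m'%:R :> R) by rewrite addnS natrD.
have e1 : m'.+1%:R = m'%:R + 1 :> R by rewrite -natr1.
have e2 : m'.+2%:R = m'%:R + 2 :> R by rewrite -addn2 natrD.
rewrite !(natrD, natrM) nm1 e1 e2.
have m'0 : 0 <= m'%:R :> R by [].
move: (n%:R : R) (m'%:R : R) m'0 => N M' M0 h.
have s0 : 0 < 2 * (M' + 2) by lra.
rewrite -(ler_pM2l s0).
have -> : 2 * (M' + 2) * ((N + (M' + 1)) / 2 * (p^-1 - 2^-1) + (M' + 1) / (2 * (M' + 2))) =
  (M' + 2) * (N + M' + 1) * p^-1 - (M' + 2) * (N + M' + 1) / 2 + (M' + 1).
  by field; rewrite !gt_eqF //; lra.
lra.
Qed.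

End exponent.

Unset Implicit Arguments.

Theorem theorem1p1 (R : realType) (n m : nat) (p : R)
    (hn : (3 <= n)%N) (hp : 2 <= p) (hm : (1 <= m <= n)%N) :
  (((n + m)%:R / 2 * (p^-1 - 2^-1) + m%:R / (2 * (m.+1)%:R) : R)%:E
     <= gamma_bar n p)%E.
Proof.
apply: le_ereal_inf_tmp => _ [gamma Hg <-]; rewrite lee_fin.
by apply: maximal_exponent_ge Hg => //; lra.
Qed.
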